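(* Let $\mu$ be a probability measure on $\mathbb{N}=\{1,2,\ldots\}$ such that the greatest common divisor of its support is equal to one. If $G_\mu$ has one component almost surely, then there are no extremal $\mu$-Gibbs measures other than the two trivial ones $\lambda_0$ and $\lambda_1$, which assign unit mass to the constant function $-1$ and to the constant function $+1$ respectively. If $G_\mu$ has infinitely many components almost surely, then the set of extremal $\mu$-Gibbs measures is the family $\{\lambda_p : p\in[0,1]\}$.
   Context: $G_\mu$ is the random directed graph with vertex set $\mathbb{Z}$ in which each $z\in\mathbb{Z}$ has a unique outgoing edge, pointing to its parent $z-k_z$, where $(k_z)_{z\in\mathbb{Z}}$ are independent with law $\mu$. Components of $G_\mu$ are those of the underlying undirected graph. The ancestral line of $z$ is the decreasing sequence whose first element is $z$ and each of whose terms is the parent of the previous one; its elements are the ancestors of $z$. A probability law $\lambda$ on functions $\mathbb{Z}\to\{-1,1\}$ is a $\mu$-Gibbs measure if, for every half-infinite interval $R=\{x,x+1,\ldots\}$ ($x\in\mathbb{Z}$), the conditional law under $\lambda$ of the values on $R$, given the values on $R^c$, is given by sampling $G_\mu$ and assigning to each element of $R$ the value assigned to its most recent ancestor in $R^c$ (i.e. the largest element of its ancestral line lying in $R^c$). A $\mu$-Gibbs measure is extremal if it cannot be written as an average of two distinct $\mu$-Gibbs measures. When $G_\mu$ has infinitely many components a.s., $\lambda_p$ ($p\in[0,1]$) is the law obtained by sampling $G_\mu$, independently giving each component the value $1$ with probability $p$ or $-1$ with probability $1-p$, and assigning to every vertex the value of its component. *)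

(* Defs.v *)
From HB Require Import structures.
From Stdlib Require Import Relation_Operators.
From mathcomp Require Import all_boot all_order all_algebra finmap.
From mathcomp Require Import all_classical all_reals all_analysis.
From mathcomp Require Import measurable_realfun.

Set Implicit Arguments.
Unset Strict Implicit.
Unset Printing Implicit Defensive.

Import Order.TTheory GRing.Theory Num.Theory.

Local Open Scope classical_set_scope.
Local Open Scope ring_scope.

Definition law_support (R : realType) (mu : probability nat R) : set nat :=
  [set n | mu [set n] != 0%E].

Definition is_gcd (A : set nat) (g : nat) : Prop :=
  (forall n, A n -> (g %| n)%N) /\
  (forall e, (forall n, A n -> (e %| n)%N) -> (e %| g)%N).

Definition mutually_independent (R : realType) (d : measure_display)
    (Omega : measurableType d) (P : probability Omega R)
    (I : choiceType) (S : I -> set_system Omega) : Prop :=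
  forall (F : {fset I}) (A : I -> set Omega),
    (forall i, i \in F -> S i (A i)) ->
    P (\bigcap_(i in [set` F]) A i) = (\prod_(i <- F) P (A i))%E.

Definition parent (k : int -> nat) (z : int) : int := z - (k z)%:Z.

Definition ancestor (k : int -> nat) (z w : int) : Prop :=
  exists n, w = iter n (parent k) z.

Definition edge (k : int -> nat) (z w : int) : Prop := parent k z = w.

Definition component (k : int -> nat) (z : int) : set int :=
  [set w | clos_refl_sym_trans int (edge k) z w].

Definition components (k : int -> nat) : set_system int :=
  range (component k).

Definition is_last_ancestor_below (k : int -> nat) (x z w : int) : Prop :=
  [/\ ancestor k z w, w < x &
      forall v, ancestor k z v -> v < x -> v <= w].

(* The default value z is taken only when no ancestor of z is below x, which *)
(* cannot happen if k is everywhere positive.                                *)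
Definition last_ancestor_below (k : int -> nat) (x z : int) : int :=
  xget z [set w | is_last_ancestor_below k x z w].

(* Spins are booleans: true stands for +1 and false for -1.                  *)
Definition coordinate_events (S : set int) : set_system (int -> bool) :=
  [set A | exists2 z, S z & exists b, A = [set s | s z = b]].

(* All functions int -> bool, with the sigma-algebra of the values on S.     *)
Definition spins_on (S : set int) := g_sigma_algebraType (coordinate_events S).

Definition config := spins_on setT.

Definition same_law (R : realType) (d : measure_display)
    (T : measurableType d) (l1 l2 : set T -> \bar R) : Prop :=
  forall A, measurable A -> l1 A = l2 A.

(* kappa is a version of the conditional law, under lam, of the spins on S2
   given the spins on S1.                                                    *)
Definition is_conditional_law (R : realType) (lam : probability config R)
    (S1 S2 : set int) (kappa : config -> set config -> \bar R) : Prop :=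
  (forall B : set (spins_on S2), measurable B ->
     measurable_fun [set: spins_on S1] (kappa ^~ B : spins_on S1 -> \bar R)) /\
  (forall (A : set (spins_on S1)) (B : set (spins_on S2)),
     measurable A -> measurable B ->
     lam (A `&` B) = (\int[lam]_(s in A) kappa s B)%E).

Definition resample (k : int -> nat) (x : int) (s : config) : config :=
  fun z => if x <= z then s (last_ancestor_below k x z) else s z.

Section random_graph.
Context (R : realType) (d : measure_display) (Omega : measurableType d)
  (P : probability Omega R).
Implicit Types (k : int -> {RV P >-> nat}) (c : int -> {RV P >-> bool}).

Definition steps k (w : Omega) : int -> nat := fun z => k z w.

Definition samples_graph (mu : probability nat R) k : Prop :=
  (forall z, same_law (distribution P (k z)) mu) /\
  mutually_independent P (fun z => g_sigma_algebra_preimage (k z)).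

Definition gibbs k (lam : probability config R) : Prop :=
  forall x : int,
    is_conditional_law lam [set z | z < x] [set z | x <= z]
      (fun s B => P [set w | B (resample (steps k w) x s)]).

(* "Average" is read as an arbitrary nontrivial convex combination.          *)
Definition extremal_gibbs k (lam : probability config R) : Prop :=
  gibbs k lam /\
  forall (lam1 lam2 : probability config R) (t : R),
    gibbs k lam1 -> gibbs k lam2 -> 0 < t < 1 ->
    same_law lam (fun A => t%:E * lam1 A + (1 - t)%:E * lam2 A)%E ->
    same_law lam1 lam2.

Definition component_coins k (p : R) c : Prop :=
  (forall z, P (c z @^-1` [set true]) = p%:E) /\
  mutually_independent P (fun i : int + int =>
    match i with
    | inl z => g_sigma_algebra_preimage (k z)
    | inr z => g_sigma_algebra_preimage (c z)
    end).

(* A component receives the coin of its element that comes first in the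
   enumeration of int given by pickle.                                       *)
Definition leader (C : set int) : int :=
  xget 0 [set z | C z /\ forall v, C v -> (choice.pickle z <= choice.pickle v)%N].

Definition component_coloring k c (w : Omega) : config :=
  fun z => c (leader (component (steps k w) z)) w.

Definition lambda_law k c : set config -> \bar R :=
  pushforward P (component_coloring k c).

End random_graph.

(* Main.v *)
Require Import Defs.
From HB Require Import structures.
From mathcomp Require Import all_boot all_order all_algebra finmap.
From mathcomp Require Import all_classical all_reals all_analysis.
From mathcomp Require Import measurable_realfun.
From mathcomp Require Import zify ring lra.

Set Implicit Arguments.
Unset Strict Implicit.
Unset Printing Implicit Defensive.

Import Order.TTheory GRing.Theory Num.Theory.
Import numFieldNormedType.Exports.

Local Open Scope classical_set_scope.
Local Open Scope ring_scope.

(** Write g V for the probability, under a measure lam, that all spins of the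
finite list V of sites are +1. Averaging the Gibbs condition over the graph
turns it into one family of equations: for every level x, g V is the mean of g
over the sites at which the ancestral lines of V enter (-oo, x). So Gibbs
measures are the same thing as functions that are harmonic for coalescing
ancestral lines (gibbsP), and the theorem is about such functions.

If there is one component, the lines of any two sites have the same entry point
below a low enough level, so g V = g [:: 0] for nonempty V and lam is a mixture
of the two constant configurations.

If there are several, let M_n be the conditional probability, given the spins
below -n, that the spin of u is +1. It is a reversed martingale: for m <= n,
E (M_n - M_m)^2 = E M_m^2 - E M_n^2. Hence lam weighted by M_n converges, to a
measure whose normalization is again Gibbs, and so does lam weighted by
1 - M_n. As lam is a mixture of the two normalized limits, extremality makes
them equal: far down its ancestral line the spin of u becomes independent of
the spins of any V (extremal_density), and is +1 with probability
p = g [:: u]. This p does not depend on u, because it is a bounded harmonic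
function of a random walk whose steps have greatest common divisor one, and such
a function is constant (bounded_harmonic_cst).

Such a density p determines g. As long as the line of u avoids the lines of V it
moves independently of them, so |g (u :: V) - p g V| is at most the probability
that the line of u meets those of V (density_error). Run all lines down to a
very low level: with probability close to one, the lines that will ever meet
have merged by then; if the line of u has merged, the list has become shorter,
and otherwise the bound just stated is close to zero. Induction on the size of
the list gives uniqueness (spin_function_unique).

Finally lambda_p has density p. The variance of M_n under lambda_p is p - p^2
times the probability that two independent lines, run down to -n and then
continued in a common graph, meet. This probability decreases with n to a limit
t which is harmonic in both starting points, hence constant. Let q be the
probability that two lines of the same graph meet. Along two coalescing lines
q - t is a martingale, nonnegative, and equal to 1 - t once they have merged, so
q - t >= (1 - t) q: either t = 0, or q = 1 for all pairs and there is only one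
component (tail_meet0). So the variance tends to zero. In a decomposition of
lambda_p as a mixture of Gibbs measures it then tends to zero under both
of them as well; they have density p, and are lambda_p by uniqueness
(coin_component_eq). *)

(** * Expectations of bounded measurable functions *)

Section bounded_functions.
Context d (T : measurableType d) (R : realType).
Implicit Types f g : T -> R.

(** One side condition, stable under sums, products and partial integration, that
yields integrability, Fubini and bounded convergence. *)
Definition bounded_mfun f := measurable_fun setT f /\ exists M, forall x, `|f x| <= M.

Lemma bmf_cst r : bounded_mfun (fun=> r).
Proof. by split=> //; exists `|r|. Qed.

Lemma bmfD f g : bounded_mfun f -> bounded_mfun g -> bounded_mfun (fun x => f x + g x).
Proof.
move=> [mf [M fM]] [mg [N gN]]; split; first exact: measurable_funD.
by exists (M + N) => x; rewrite (le_trans (ler_normD _ _))// lerD.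
Qed.

Lemma bmfM f g : bounded_mfun f -> bounded_mfun g -> bounded_mfun (fun x => f x * g x).
Proof.
move=> [mf [M fM]] [mg [N gN]]; split; first exact: measurable_funM.
by exists (M * N) => x; rewrite normrM ler_pM.
Qed.

Lemma bmfB f g : bounded_mfun f -> bounded_mfun g -> bounded_mfun (fun x => f x - g x).
Proof.
move=> [mf [M fM]] [mg [N gN]]; split; first exact: measurable_funB.
by exists (M + N) => x; rewrite (le_trans (ler_normB _ _))// lerD.
Qed.

Lemma bmfX f n : bounded_mfun f -> bounded_mfun (fun x => f x ^+ n).
Proof.
move=> bf; elim: n => [|n IH]; first exact: bmf_cst.
by under eq_fun do rewrite exprS; exact: bmfM.
Qed.

Lemma bmf_indic (A : set T) : measurable A -> bounded_mfun \1_A.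
Proof.
move=> mA; split; first exact: measurable_indic.
by exists 1 => x; rewrite indicE; case: (_ \in _); rewrite ?normr1 ?normr0.
Qed.

End bounded_functions.

Lemma bmf_comp d (T : measurableType d) d' (T' : measurableType d')
    (R : realType) (h : T -> T') (f : T' -> R) :
  measurable_fun setT h -> bounded_mfun f -> bounded_mfun (f \o h).
Proof.
move=> mh [mf [M fM]]; split; first exact: measurableT_comp.
by exists M => x /=.
Qed.

Section expectation.
Context d (T : measurableType d) (R : realType) (P : probability T R).
Implicit Types f g : T -> R.

Lemma bmf_integrable f : bounded_mfun f -> P.-integrable setT (EFin \o f).
Proof.
move=> [mf [M fM]]; apply: measurable_bounded_integrable => //.
  by rewrite -ge0_fin_numE// fin_num_measure.
exists M; split; first exact: num_real.
by move=> N MN x _; apply: (le_trans (fM x)); exact: ltW.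
Qed.

Lemma EFin_Ex f : bounded_mfun f -> (\int[P]_x f x)%:E = (\int[P]_x (f x)%:E)%E.
Proof. by move=> /bmf_integrable bf; rewrite fineK// integrable_fin_num. Qed.

Lemma Ex_cst r : \int[P]_x r = r.
Proof. by rewrite Rintegral_cst//= (probability_setT P) mulr1. Qed.

Lemma ExD f g : bounded_mfun f -> bounded_mfun g ->
  \int[P]_x (f x + g x) = \int[P]_x f x + \int[P]_x g x.
Proof. by move=> bf bg; rewrite RintegralD//; exact: bmf_integrable. Qed.

Lemma ExB f g : bounded_mfun f -> bounded_mfun g ->
  \int[P]_x (f x - g x) = \int[P]_x f x - \int[P]_x g x.
Proof. by move=> bf bg; rewrite RintegralB//; exact: bmf_integrable. Qed.

Lemma ExZ r f : bounded_mfun f -> \int[P]_x (r * f x) = r * \int[P]_x f x.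
Proof. by move=> bf; rewrite RintegralZl//; exact: bmf_integrable. Qed.

Lemma Ex_le f g : bounded_mfun f -> bounded_mfun g -> (forall x, f x <= g x) ->
  \int[P]_x f x <= \int[P]_x g x.
Proof. by move=> bf bg fg; apply: le_Rintegral => //; exact: bmf_integrable. Qed.

Lemma Ex_ge0 f : (forall x, 0 <= f x) -> 0 <= \int[P]_x f x.
Proof. by move=> f0; apply: Rintegral_ge0. Qed.

Lemma eq_Ex f g : f =1 g -> \int[P]_x f x = \int[P]_x g x.
Proof. by move=> fg; apply: eq_Rintegral => x _. Qed.

Lemma Ex_indic (A : set T) : measurable A -> \int[P]_x \1_A x = fine (P A).
Proof. by move=> mA; rewrite /Rintegral integral_indic// setIT. Qed.

Lemma fineK_prob (A : set T) : measurable A -> (fine (P A))%:E = P A.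
Proof. by move=> mA; rewrite fineK// fin_num_measure. Qed.

(** The variance is nonnegative. *)
Lemma sqr_Ex_le f : bounded_mfun f -> (\int[P]_x f x) ^+ 2 <= \int[P]_x (f x ^+ 2).
Proof.
move=> bf; set m := \int[P]_x f x.
have b2 : bounded_mfun (fun x => f x ^+ 2) by exact: bmfX.
have : 0 <= \int[P]_x ((f x ^+ 2 - (2 * m) * f x) + m ^+ 2).
  by apply: Ex_ge0 => x; rewrite (_ : _ + _ = (f x - m) ^+ 2) ?sqr_ge0//; ring.
have bm : bounded_mfun (fun x => 2 * m * f x) by apply: bmfM => //; exact: bmf_cst.
rewrite ExD//; [|exact: bmfB|exact: bmf_cst].
by rewrite ExB// ExZ// Ex_cst -/m; nra.
Qed.

Lemma sqr_Ex_indic_le (h : T -> R) (A : set T) : bounded_mfun h -> measurable A ->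
  (\int[P]_s (h s * \1_A s)) ^+ 2 <= \int[P]_s (h s ^+ 2).
Proof.
move=> bh mA; have bA := bmf_indic R mA.
apply: le_trans (sqr_Ex_le (bmfM bh bA)) _.
apply: Ex_le => [||s]; [exact: bmfX (bmfM bh bA)|exact: bmfX|].
rewrite exprMn indicE; case: (_ \in _); rewrite ?expr1n ?mulr1// expr0n mulr0.
exact: sqr_ge0.
Qed.

Lemma Ex_cvg (f_ : nat -> T -> R) f M :
  (forall n, measurable_fun setT (f_ n)) -> (forall n x, `|f_ n x| <= M) ->
  (forall x, f_ ^~ x @ \oo --> f x) ->
  bounded_mfun f /\ \int[P]_x f_ n x @[n --> \oo] --> \int[P]_x f x.
Proof.
move=> mf_ fM f_f.
have mf : measurable_fun setT f.
  by apply: (measurable_fun_cvg mf_) => x _; exact: f_f.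
have bf : bounded_mfun f.
  split=> //; exists M => x.
  have cn : `|f_ n x| @[n --> \oo] --> `|f x| by apply: cvg_norm; exact: f_f.
  rewrite -(cvg_lim (@Rhausdorff R) cn); apply: limr_le.
    by apply/cvg_ex; eexists; exact: cn.
  by apply: nearW => n.
have bn n : bounded_mfun (f_ n) by split=> //; exists M.
split=> //.
have [] := @dominated_convergence _ T R P setT measurableT
  (fun n => EFin \o f_ n) (EFin \o f) (fun=> M%:E).
- by move=> n; exact/measurable_EFinP.
- exact/measurable_EFinP.
- by apply: aeW => x _; apply: cvg_EFin; [exact: nearW|exact: f_f].
- exact: (bmf_integrable (bmf_cst _ _)).
- by apply: aeW => x n _; rewrite /= lee_fin.
move=> _ _; rewrite -EFin_Ex// => H.
by apply: (fine_cvg H).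
Qed.

End expectation.

Lemma unit_bounded (U : Type) (R : realType) (phi : U -> R) :
  (forall u, 0 <= phi u <= 1) -> exists M, forall u, `|phi u| <= M.
Proof. by move=> p01; exists 1 => u; have /andP[p0 p1] := p01 u; rewrite ger0_norm. Qed.

Section expectation_bounds.
Context d (T : measurableType d) (R : realType) (P : probability T R).

Lemma Ex_norm_le (f h : T -> R) : bounded_mfun f -> bounded_mfun h ->
  (forall x, `|f x| <= h x) -> `|\int[P]_x f x| <= \int[P]_x h x.
Proof.
move=> bf bh fh.
have fhh x : - h x <= f x <= h x by rewrite -ler_norml.
rewrite ler_norml; apply/andP; split; last first.
  by apply: Ex_le => // x; have /andP[] := fhh x.
rewrite -mulN1r -ExZ//; apply: Ex_le => // [|x]; last first.
  by rewrite mulN1r; have /andP[] := fhh x.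
by apply: bmfM => //; exact: bmf_cst.
Qed.

Lemma Ex_unit (f : T -> R) : bounded_mfun f -> (forall x, 0 <= f x <= 1) ->
  0 <= \int[P]_x f x <= 1.
Proof.
move=> bf f01; apply/andP; split.
  by apply: Ex_ge0 => x; have /andP[] := f01 x.
rewrite -(Ex_cst P 1); apply: Ex_le => //; first exact: bmf_cst.
by move=> x; have /andP[] := f01 x.
Qed.

Lemma Ex_cvg_eventually (f_ : nat -> T -> R) f M :
  (forall n, bounded_mfun (f_ n)) -> (forall n x, `|f_ n x| <= M) ->
  (forall x, exists N, forall n, (N <= n)%N -> f_ n x = f x) ->
  \int[P]_x f_ n x @[n --> \oo] --> \int[P]_x f x.
Proof.
move=> bf fM ev.
have ptw x : f_ n x @[n --> \oo] --> f x.
  have [N HN] := ev x; apply: cvg_near_cst.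
  by apply: filterS (nbhs_infty_ge N) => n /=; exact: HN.
by have [] := Ex_cvg P (fun n => (bf n).1) fM ptw.
Qed.

End expectation_bounds.

Lemma cvg_near_eq (R : realType) (f g : nat -> R) (l : R) N :
  (forall n, (N <= n)%N -> f n = g n) ->
  g n @[n --> \oo] --> l -> f n @[n --> \oo] --> l.
Proof.
move=> fg; apply: cvg_trans; apply: near_eq_cvg.
by apply: filterS (nbhs_infty_ge N) => n /= /fg ->.
Qed.

Section product_expectation.
Context d1 (T1 : measurableType d1) d2 (T2 : measurableType d2) (R : realType).
Variables (P1 : probability T1 R) (P2 : probability T2 R).
Implicit Type f : T1 * T2 -> R.

Lemma prod_setT_eq1 : (P1 \x P2)%E setT = 1%E.
Proof.
by rewrite -setXTT product_measure1E//= (probability_setT P1) (probability_setT P2) mule1.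
Qed.

HB.instance Definition _ := @Measure_isProbability.Build _ _ R
  (P1 \x P2)%E prod_setT_eq1.

Definition pprod : probability (T1 * T2)%type R := (P1 \x P2)%E.

Lemma pprodE (A : set T1) (B : set T2) : measurable A -> measurable B ->
  pprod (A `*` B) = (P1 A * P2 B)%E.
Proof. by move=> mA mB; rewrite /pprod/= product_measure1E. Qed.

Lemma bmf_section1 f x : bounded_mfun f -> bounded_mfun (fun y => f (x, y)).
Proof. by move=> bf; apply: (bmf_comp _ bf); exact: measurable_pair1. Qed.

Lemma bmf_section2 f y : bounded_mfun f -> bounded_mfun (fun x => f (x, y)).
Proof. by move=> bf; apply: (bmf_comp _ bf); exact: measurable_pair2. Qed.

Lemma bmf_Ex2 f : bounded_mfun f -> bounded_mfun (fun x => \int[P2]_y f (x, y)).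
Proof.
move=> bf; split.
  apply/measurable_EFinP.
  rewrite (_ : _ \o _ = fubini_F P2 (EFin \o f)); last first.
    by apply/funext => x /=; rewrite EFin_Ex//; exact: bmf_section1.
  by apply: measurable_fubini_F; exact: (@bmf_integrable _ _ _ pprod _ bf).
have [mf [M fM]] := bf; exists M => x.
have bx := bmf_section1 x bf.
have fMM y : - M <= f (x, y) <= M by rewrite -ler_norml.
rewrite ler_norml; apply/andP; split.
  rewrite -(Ex_cst P2 (- M)); apply: Ex_le => // [|y]; first exact: bmf_cst.
  by have /andP[] := fMM y.
rewrite -(Ex_cst P2 M); apply: Ex_le => // [|y]; first exact: bmf_cst.
by have /andP[] := fMM y.
Qed.

Lemma bmf_Ex1 f : bounded_mfun f -> bounded_mfun (fun y => \int[P1]_x f (x, y)).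
Proof.
move=> bf; split.
  apply/measurable_EFinP.
  rewrite (_ : _ \o _ = fubini_G P1 (EFin \o f)); last first.
    by apply/funext => x /=; rewrite EFin_Ex//; exact: bmf_section2.
  by apply: measurable_fubini_G; exact: (@bmf_integrable _ _ _ pprod _ bf).
have [mf [M fM]] := bf; exists M => y.
have bx := bmf_section2 y bf.
have fMM x : - M <= f (x, y) <= M by rewrite -ler_norml.
rewrite ler_norml; apply/andP; split.
  rewrite -(Ex_cst P1 (- M)); apply: Ex_le => // [|x]; first exact: bmf_cst.
  by have /andP[] := fMM x.
rewrite -(Ex_cst P1 M); apply: Ex_le => // [|x]; first exact: bmf_cst.
by have /andP[] := fMM x.
Qed.

Lemma Ex_prod12 f : bounded_mfun f ->
  \int[pprod]_z f z = \int[P1]_x \int[P2]_y f (x, y).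
Proof.
move=> bf; apply: EFin_inj; rewrite !EFin_Ex//; last exact: bmf_Ex2.
rewrite -[LHS](integral12_prod_meas1 (@bmf_integrable _ _ _ pprod _ bf)).
by apply: eq_integral => x _; rewrite EFin_Ex//; exact: bmf_section1.
Qed.

Lemma Ex_prod21 f : bounded_mfun f ->
  \int[pprod]_z f z = \int[P2]_y \int[P1]_x f (x, y).
Proof.
move=> bf; apply: EFin_inj; rewrite !EFin_Ex//; last exact: bmf_Ex1.
rewrite -[LHS](integral21_prod_meas1 (@bmf_integrable _ _ _ pprod _ bf)).
by apply: eq_integral => x _; rewrite EFin_Ex//; exact: bmf_section2.
Qed.

Lemma Ex_swap f : bounded_mfun f ->
  \int[P1]_x \int[P2]_y f (x, y) = \int[P2]_y \int[P1]_x f (x, y).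
Proof. by move=> bf; rewrite -Ex_prod12// Ex_prod21. Qed.

End product_expectation.

Section product_sections.
Context d1 (T1 : measurableType d1) d2 (T2 : measurableType d2) (R : realType).
Variables (P1 : probability T1 R) (P2 : probability T2 R).

Lemma pprod12 X : measurable X ->
  pprod P1 P2 X = (\int[P1]_x P2 [set y | X (x, y)])%E.
Proof.
move=> mX; apply: eq_integral => x _ /=.
by congr (P2 _); apply/seteqP; split=> y; rewrite /xsection/= inE.
Qed.

Lemma pprod21 X : measurable X ->
  pprod P1 P2 X = (\int[P2]_y P1 [set x | X (x, y)])%E.
Proof.
move=> mX; transitivity ((P1 \x^ P2)%E X).
  by apply: product_measure_unique => // A B mA mB; exact: product_measure2E.
apply: eq_integral => y _ /=.
by congr (P1 _); apply/seteqP; split=> x; rewrite /ysection/= inE.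
Qed.

End product_sections.

Section image_law.
Context d (T : measurableType d) d' (T' : measurableType d') (R : realType).
Variable P : probability T R.

Definition law (X : T -> T') (mX : measurable_fun setT X) :
    probability T' R := distribution P (mfun_Sub (mem_set mX)).

Lemma lawE X (mX : measurable_fun setT X) A : law mX A = P (X @^-1` A).
Proof. by []. Qed.

Lemma Ex_law X (mX : measurable_fun setT X) f : bounded_mfun f ->
  \int[law mX]_y f y = \int[P]_x f (X x).
Proof.
move=> bf; rewrite /Rintegral; congr fine.
have := @integral_pushforward _ _ _ _ R X mX P setT (EFin \o f).
apply => //; first by apply/measurable_EFinP; case: bf.
by rewrite preimage_setT; exact: (bmf_integrable P (bmf_comp mX bf)).
Qed.

End image_law.

Lemma eq_Ex_measure d (T : measurableType d) (R : realType)
    (P1 P2 : probability T R) (f : T -> R) :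
  (forall A, measurable A -> P1 A = P2 A) ->
  \int[P1]_x f x = \int[P2]_x f x.
Proof.
move=> P12; rewrite /Rintegral; congr fine.
by apply: eq_measure_integral => A mA _; exact: P12.
Qed.

Lemma eq_probability_gen d (T : measurableType d) (R : realType)
    (G : set_system T) (P1 P2 : probability T R) :
  (@measurable _ T) `<=` <<s G >> -> G `<=` measurable ->
  setI_closed G -> G setT -> (forall A, G A -> P1 A = P2 A) ->
  forall A, measurable A -> P1 A = P2 A.
Proof.
move=> TG GT GI G1 P12 A mA.
apply: (g_sigma_algebra_measure_unique G GT (fun=> setT)) => //.
- by rewrite bigcup_const//; exists 0%N.
- move=> k; apply: (le_lt_trans (probability_le1 P1 measurableT)).
  by rewrite ltry.
- exact: TG.
Qed.

(** * Discrete-valued measurable maps *)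

Section discrete_valued.
Context d (T : measurableType d).

(** Measurability for the discrete sigma-algebra. For countable U it reduces to the
measurability of the fibers (dmeas_fib), and any function can be applied to the
result (dmeas_comp). *)
Definition discrete_mfun (U : Type) (h : T -> U) :=
  forall A : set U, measurable (h @^-1` A).

Lemma dmeas_cst (U : Type) (u : U) : discrete_mfun (fun=> u).
Proof.
move=> A; have [Au|nAu] := pselect (A u).
  by rewrite (_ : _ @^-1` _ = setT)//; apply/seteqP; split.
by rewrite (_ : _ @^-1` _ = set0)//; apply/seteqP; split.
Qed.

Lemma dmeas_comp (U V : Type) (g : U -> V) (h : T -> U) :
  discrete_mfun h -> discrete_mfun (g \o h).
Proof. by move=> mh A; rewrite comp_preimage; exact: mh. Qed.

(** A random choice among countably many discrete-valued maps, by a union over the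
possible choices. *)
Lemma dmeas_bind (U : countType) (V : Type) (h : T -> U) (F : U -> T -> V) :
  discrete_mfun h -> (forall u, discrete_mfun (F u)) -> discrete_mfun (fun x => F (h x) x).
Proof.
move=> mh mF A.
rewrite (_ : _ @^-1` _ = \bigcup_(u in setT) (h @^-1` [set u] `&` F u @^-1` A)).
  apply: countable_bigcupT_measurable => [|u]; first exact: countableP.
  by apply: measurableI; [exact: mh|exact: mF].
apply/seteqP; split=> [x Ax|x [u _ [/= -> //]]].
by exists (h x).
Qed.

Lemma dmeas_fib (U : countType) (h : T -> U) :
  (forall u, measurable (h @^-1` [set u])) -> discrete_mfun h.
Proof.
move=> mh A.
rewrite (_ : _ @^-1` _ =
    \bigcup_(u in setT) (if `[< A u >] then h @^-1` [set u] else set0)).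
  apply: countable_bigcupT_measurable => [|u]; first exact: countableP.
  by case: ifP.
apply/seteqP; split=> [x Ax|x [u _]]; last first.
  by case: ifP => // /asboolP Au /= ->.
by exists (h x) => //; case: ifP => // /asboolP.
Qed.

Lemma dmeas2 (U : countType) (V : countType) (W : Type) (g : U -> V -> W)
    (h : T -> U) (k : T -> V) :
  discrete_mfun h -> discrete_mfun k -> discrete_mfun (fun x => g (h x) (k x)).
Proof.
move=> mh mk; apply: (dmeas_bind (F := fun u x => g u (k x)) mh) => u.
exact: (dmeas_comp (g u) mk).
Qed.

Lemma dmeas_map (I : Type) (U : countType) (h : I -> T -> U) (s : seq I) :
  (forall i, discrete_mfun (h i)) -> discrete_mfun (fun x => [seq h i x | i <- s]).
Proof.
move=> mh; elim: s => [|i s IH]; first exact: dmeas_cst.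
exact: (dmeas2 cons (mh i) IH).
Qed.

Lemma dmeas_bmf (R : realType) (U : Type) (h : T -> U) (f : U -> R) :
  discrete_mfun h -> (exists M, forall u, `|f u| <= M) -> bounded_mfun (f \o h).
Proof.
move=> mh [M fM]; split; last by exists M => x /=.
by move=> _ Y mY; rewrite setTI comp_preimage; exact: mh.
Qed.

End discrete_valued.

Lemma measurable_dmeas d (T : measurableType d) d' (T' : measurableType d')
    (U : Type) (k : T -> T') (h : T' -> U) :
  measurable_fun setT k -> discrete_mfun h -> discrete_mfun (h \o k).
Proof. by move=> mk mh A; rewrite comp_preimage -[X in measurable X]setTI; exact: mk. Qed.

Lemma measurable_exists d (T : measurableType d) (U : countType)
    (A : U -> set T) :
  (forall u, measurable (A u)) -> measurable [set x | exists u, A u x].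
Proof.
move=> mA; rewrite (_ : mkset _ = \bigcup_(u in setT) A u).
  by apply: countable_bigcupT_measurable => //; exact: countableP.
by apply/seteqP; split=> [x [u Au]|x [u _ Au]]; exists u.
Qed.

Lemma measurable_forall d (T : measurableType d) (U : countType)
    (A : U -> set T) :
  (forall u, measurable (A u)) -> measurable [set x | forall u, A u x].
Proof.
move=> mA; rewrite (_ : mkset _ = ~` [set x | exists u, (~` A u) x]).
  by apply/measurableC/measurable_exists => u; exact/measurableC/mA.
apply/seteqP; split=> x /=; first by move=> H [u nA]; exact: nA (H u).
by move=> H u; apply: contrapT => nA; apply: H; exists u.
Qed.

(** * Independent families of integers and splicing *)

Section families.
Variable I : choiceType.

Definition coordinate_sets : set_system (I -> nat) :=
  [set A | exists i n, A = [set f | f i = n]].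

Definition nat_family := g_sigma_algebraType coordinate_sets.

Lemma dmeas_coord (i : I) : discrete_mfun (fun f : nat_family => f i).
Proof. by apply: dmeas_fib => n; apply: sub_sigma_algebra; exists i, n. Qed.

Lemma measurable_to_family d (T : measurableType d) (h : T -> nat_family) :
  (forall i, discrete_mfun (fun x => h x i)) -> measurable_fun setT h.
Proof.
move=> mh; apply: (@measurability _ _ _ _ _ h coordinate_sets) => //.
by move=> _ [_ [i [n ->]] <-]; rewrite setTI; exact: (mh i [set n]).
Qed.

Definition boxes : set_system nat_family :=
  [set A | exists (F : seq I) (B : I -> set nat),
     A = [set f | forall i, i \in F -> B i (f i)]].

Lemma box_measurable d (T : measurableType d) (h : T -> nat_family) F B :
  (forall i, discrete_mfun (fun x => h x i)) ->
  measurable [set x | forall i : I, i \in (F : seq I) -> B i (h x i)].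
Proof.
move=> mh; elim: F => [|i F IH].
  rewrite [X in measurable X](_ : _ = setT)//; exact/seteqP.
rewrite [X in measurable X](_ : _ = (fun x => h x i) @^-1` B i `&`
  [set x | forall i : I, i \in (F : seq I) -> B i (h x i)]).
  by apply: measurableI => //; exact: mh.
apply/seteqP; split=> x /=.
  by move=> H; split=> [|j jF]; apply: H; rewrite inE ?eqxx ?jF ?orbT.
by move=> [H1 H2] j; rewrite inE => /orP[/eqP ->//|]; exact: H2.
Qed.

Lemma eq_probability_family (R : realType) (P1 P2 : probability nat_family R) :
  (forall A, boxes A -> P1 A = P2 A) ->
  forall A, measurable A -> P1 A = P2 A.
Proof.
move=> P12; apply: (eq_probability_gen (G := boxes)) => //.
- apply: smallest_sub => [|_ [i [n ->]]]; first exact: smallest_sigma_algebra.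
  apply: sub_sigma_algebra; exists [:: i], (fun=> [set n]); apply/seteqP; split=> f /=.
    by move=> <- j; rewrite inE => /eqP ->.
  by apply; rewrite inE.
- by move=> _ [F [B ->]]; apply: (box_measurable (h := id)); exact: dmeas_coord.
- move=> _ _ [F [B ->]] [F' [B' ->]]; exists (F ++ F').
  exists (fun i n => (i \in F -> B i n) /\ (i \in F' -> B' i n)).
  apply/seteqP; split=> f /=.
    by move=> [H H'] i _; split; [exact: H|exact: H'].
  by move=> H; split=> i iF; have := H i; rewrite mem_cat iF ?orbT => -[]// H1 H2;
    [exact: H1|exact: H2].
- by exists [::], (fun=> setT); apply/seteqP; split.
Qed.

Definition splice (S : pred I) (f g : nat_family) : nat_family :=
  fun i => if S i then f i else g i.

Lemma measurable_splice S :
  measurable_fun setT (fun z : nat_family * nat_family => splice S z.1 z.2).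
Proof.
apply: measurable_to_family => i; rewrite /splice; case: (S i).
  exact: (measurable_dmeas measurable_fst (dmeas_coord i)).
exact: (measurable_dmeas measurable_snd (dmeas_coord i)).
Qed.

Section splice_law.
Variables (R : realType) (Q : probability nat_family R).
Hypothesis Qindep : forall (F : seq I) (B : I -> set nat), uniq F ->
  Q [set f | forall i, i \in F -> B i (f i)] =
  (\prod_(i <- F) Q [set f | B i (f i)])%E.

(** Replacing the coordinates outside S by those of an independent copy does not
change the law of an independent family. Both sides are products on boxes, and
boxes form a generating pi-system. *)
Lemma splice_law S A : measurable A ->
  Q A = pprod Q Q [set z | A (splice S z.1 z.2)].
Proof.
move: A; apply: (@eq_probability_family R Q (law (pprod Q Q) (measurable_splice S))).
move=> _ [F [B ->]]; rewrite (lawE _ (measurable_splice S)).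
have mb D := @box_measurable _ _ id (undup F) D dmeas_coord.
(* The spliced box is the product of its constraints on S and off S. *)
pose B1 i := if S i then B i else setT.
pose B2 i := if S i then setT else B i.
rewrite (_ : _ @^-1` _ =
  [set f | forall i, i \in undup F -> B1 i (f i)] `*`
  [set f | forall i, i \in undup F -> B2 i (f i)]); last first.
  apply/seteqP; split=> -[f g] /=.
    rewrite /splice/= /B1 /B2 => H.
    by split=> i; rewrite mem_undup => /H; case: (S i).
  rewrite /splice/= /B1 /B2 => -[H1 H2] i; rewrite -mem_undup => iF.
  by have := H1 _ iF; have := H2 _ iF; case: (S i).
rewrite pprodE; [|exact: mb|exact: mb].
rewrite (_ : [set _ | _] = [set f | forall i, i \in undup F -> B i (f i)]).
  rewrite !Qindep ?undup_uniq// -big_split/=; apply: eq_bigr => i _.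
  rewrite /B1 /B2; case: (S i).
    have -> : [set f : nat_family | setT (f i)] = setT by exact/seteqP.
    by rewrite probability_setT mule1.
  have -> : [set f : nat_family | setT (f i)] = setT by exact/seteqP.
  by rewrite probability_setT mul1e.
by apply/seteqP; split=> f /= H i; have := H i; rewrite mem_undup.
Qed.

Lemma Ex_splice S (f : nat_family -> R) : bounded_mfun f ->
  \int[Q]_x f x = \int[Q]_x \int[Q]_y f (splice S x y).
Proof.
move=> bf.
have bs : bounded_mfun (fun z => f (splice S z.1 z.2)).
  exact: (bmf_comp (measurable_splice S) bf).
rewrite -(Ex_prod12 Q Q bs) -(Ex_law (pprod Q Q) (measurable_splice S) bf).
by apply: eq_Ex_measure => A mA; rewrite (lawE _ (measurable_splice S)) -splice_law.
Qed.

End splice_law.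
End families.

(** * Events of spin configurations *)

Section spins.

Lemma dmeas_spin (S : set int) z : S z -> discrete_mfun (fun s : spins_on S => s z).
Proof.
by move=> Sz; apply: dmeas_fib => b; apply: sub_sigma_algebra; exists z => //; exists b.
Qed.

Lemma measurable_to_spins d (T : measurableType d) S (h : T -> spins_on S) :
  (forall z, S z -> discrete_mfun (fun x => h x z)) -> measurable_fun setT h.
Proof.
move=> mh; apply: (@measurability _ _ _ _ _ h (coordinate_events S)) => //.
by move=> _ [_ [z Sz [b ->]] <-]; rewrite setTI; exact: (mh z Sz [set b]).
Qed.

Lemma measurable_spins_sub (S1 S2 : set int) (A : set (int -> bool)) :
  S1 `<=` S2 -> measurable (A : set (spins_on S1)) ->
  measurable (A : set (spins_on S2)).
Proof.
move=> S12; have mi : measurable_fun setT (id : spins_on S2 -> spins_on S1).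
  by apply: measurable_to_spins => z Sz; apply: dmeas_spin; exact: S12.
by move=> mA; have := mi measurableT A mA; rewrite setTI.
Qed.

(** The sets with this invariance form a sigma-algebra which contains the generators. *)
Lemma spins_on_local (S : set int) (A : set (int -> bool)) :
  measurable (A : set (spins_on S)) ->
  forall s s' : int -> bool, (forall z, S z -> s z = s' z) -> A s -> A s'.
Proof.
move=> mA.
pose C := [set A : set (int -> bool) | forall s s' : int -> bool,
  (forall z, S z -> s z = s' z) -> A s -> A s'].
suff : <<s (coordinate_events S) >> `<=` C by exact.
apply: smallest_sub => [|_ [z Sz [b ->]] s s' ss' /= <-]; last exact/esym/ss'.
split=> [s s' _ []|B CB s s' ss' [_ nBs]|F CF s s' ss' [n _ Fs]].
- by split=> // Bs'; apply: nBs; apply: CB Bs' => z Sz; exact/esym/ss'.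
- by exists n => //; exact: CF Fs.
Qed.

(** These events form a pi-system generating all spin events, so that a measure on
configurations is determined by one number for each finite list of sites. *)
Definition ones (V : seq int) : set (int -> bool) := [set s : int -> bool | all s V].

Lemma ones_measurable (S : set int) V : (forall z, z \in V -> S z) ->
  measurable (ones V : set (spins_on S)).
Proof.
elim: V => [|z V IH] SV; first by rewrite (_ : ones _ = setT)//; exact/seteqP.
rewrite (_ : ones _ = (fun s : spins_on S => s z) @^-1` [set true] `&` ones V).
  apply: measurableI; first by apply: dmeas_spin; apply: SV; rewrite inE eqxx.
  by apply: IH => u uV; apply: SV; rewrite inE uV orbT.
by apply/seteqP; split=> s /=; rewrite /ones/= => /andP.
Qed.

Lemma ones_config V : measurable (ones V : set config).
Proof. exact: ones_measurable. Qed.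

Lemma ones_cat V W : ones (V ++ W) = ones V `&` ones W.
Proof. by apply/seteqP; split=> s /=; rewrite /ones/= all_cat => /andP. Qed.

Lemma eq_probability_spins (R : realType) (S : set int)
    (P1 P2 : probability (spins_on S) R) :
  (forall V, (forall z, z \in V -> S z) -> P1 (ones V) = P2 (ones V)) ->
  forall A, measurable A -> P1 A = P2 A.
Proof.
pose G : set_system (spins_on S) :=
  [set A | exists2 V, (forall z, z \in V -> S z) & A = ones V].
move=> P12; apply: (eq_probability_gen (G := G)) => //.
- apply: smallest_sub => [|_ [z Sz [b ->]]]; first exact: smallest_sigma_algebra.
  have Gz : <<s G >> (ones [:: z]).
    apply: sub_sigma_algebra; exists [:: z] => // u.
    by rewrite inE => /eqP ->.
  case: b.
    by rewrite (_ : [set _ | _] = ones [:: z])//; apply/seteqP; split=> s;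
      rewrite /ones/= andbT.
  rewrite (_ : [set _ | _] = setT `\` ones [:: z]); first exact: sigma_algebraCD.
  apply/seteqP; split=> s; rewrite /ones/= andbT; first by move=> ->.
  by move=> [_ /negP/negbTE].
- by move=> _ [V SV ->]; exact: ones_measurable.
- move=> _ _ [V SV ->] [W SW ->]; exists (V ++ W); last by rewrite ones_cat.
  by move=> z; rewrite mem_cat => /orP[/SV|/SW].
- by exists [::] => //; apply/seteqP; split.
- by move=> _ [V SV ->]; exact: P12.
Qed.

End spins.

(** * Components and ancestral lines of a graph of arrows *)

Section arrow_graph.
Implicit Types k : int -> nat.

Lemma component_refl k z : component k z z.
Proof. exact: Relation_Operators.rst_refl. Qed.

Lemma component_sym k z w : component k z w -> component k w z.
Proof. exact: Relation_Operators.rst_sym. Qed.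

Lemma component_trans k x y z :
  component k x y -> component k y z -> component k x z.
Proof. exact: Relation_Operators.rst_trans. Qed.

Lemma component_eq k z w : component k z w -> component k z = component k w.
Proof.
move=> zw; apply/seteqP; split=> v zv; last exact: (component_trans zw zv).
exact: (component_trans (component_sym zw) zv).
Qed.

Lemma component_iter k n z : component k z (iter n (parent k) z).
Proof.
elim: n => [|n IH]; first exact: component_refl.
by apply: (component_trans IH); exact: Relation_Operators.rst_step.
Qed.

(** Each vertex has a single outgoing edge, so merging is the only way to be
connected. *)
Lemma componentP k z w : component k z w <->
  exists n m, iter n (parent k) z = iter m (parent k) w.
Proof.
split=> [|[n [m nm]]]; last first.
  apply: (component_trans (component_iter k n z)); rewrite nm.
  exact/component_sym/component_iter.
elim=> {z w} [z w zw|z|z w _ [n [m nm]]|z w v _ [n [m nm]] _ [n' [m' nm']]].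
- by exists 1%N, 0%N.
- by exists 0%N, 0%N.
- by exists m, n.
- exists (n' + n)%N, (m + m')%N.
  by rewrite iterD nm -iterD addnC iterD nm' -iterD.
Qed.

Lemma leaderP (C : set int) : C !=set0 ->
  C (leader C) /\
  forall v, C v -> (choice.pickle (leader C) <= choice.pickle v)%N.
Proof.
move=> [v Cv].
pose p n := `[< exists2 z, C z & choice.pickle z = n >].
have pP : exists n, p n by exists (choice.pickle v); apply/asboolP; exists v.
have [n /asboolP[u Cu un] nmin] := ex_minnP pP.
pose L := [set z | C z /\
  forall v, C v -> (choice.pickle z <= choice.pickle v)%N].
have Lu : L u.
  by split=> // w Cw; rewrite un; apply: nmin; apply/asboolP; exists w.
exact: (@xgetPex _ 0 L (ex_intro _ u Lu)).
Qed.

Definition vertex_leader k z := leader (component k z).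

Lemma component_leader k z : component k z (vertex_leader k z).
Proof. by have [] := leaderP (ex_intro _ _ (component_refl k z)). Qed.

Lemma eq_leader k z w :
  vertex_leader k z = vertex_leader k w <-> component k z w.
Proof.
split=> [zw|zw]; last by rewrite /vertex_leader (component_eq zw).
apply: component_trans (component_leader k z) _; rewrite zw.
exact/component_sym/component_leader.
Qed.

Lemma vertex_leaderP k z u : vertex_leader k z = u <->
  component k z u /\
  forall v, component k z v -> (choice.pickle u <= choice.pickle v)%N.
Proof.
have [H1 H2] := leaderP (ex_intro _ _ (component_refl k z)).
split=> [<-|[zu uv]]; first by split.
apply: (pcan_inj choice.pickleK); apply/eqP; rewrite eqn_leq.
by rewrite H2//= uv.
Qed.

Definition steps_space := nat_family int.

Lemma dmeas_iter_parent n z :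
  discrete_mfun (fun k : steps_space => iter n (parent k) z).
Proof.
elim: n => [|n IH]; first exact: dmeas_cst.
have mp u : discrete_mfun (fun k : steps_space => parent k u).
  exact: (dmeas_comp (fun n : nat => u - n%:Z) (dmeas_coord u)).
exact: (dmeas_bind IH mp).
Qed.

Lemma measurable_component z w :
  measurable [set k : steps_space | component k z w].
Proof.
rewrite (_ : mkset _ = [set k : steps_space |
    exists n m, iter n (parent k) z = iter m (parent k) w]).
  apply: measurable_exists => n; apply: measurable_exists => m.
  exact: (dmeas2 pair (dmeas_iter_parent n z) (dmeas_iter_parent m w)
     [set p | p.1 = p.2]).
by apply/seteqP; split=> k /componentP.
Qed.

Lemma dmeas_leader z : discrete_mfun (fun k : steps_space => vertex_leader k z).
Proof.
apply: dmeas_fib => u.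
rewrite (_ : _ @^-1` _ = [set k | component k z u] `&`
  [set k | forall v, (~` [set k | component k z v] `|`
    [set k | (choice.pickle u <= choice.pickle v)%N]) k]).
  apply: measurableI; first exact: measurable_component.
  apply: measurable_forall => v; apply: measurableU.
    by apply: measurableC; exact: measurable_component.
  exact: (@dmeas_cst _ steps_space _ ((choice.pickle u <= choice.pickle v)%N)
    [set b | is_true b]).
apply/seteqP; split=> k /=.
  move=> /vertex_leaderP[zu uv]; split=> // v.
  by have [/uv|] := pselect (component k z v); [right|left].
by move=> [zu uv]; apply/vertex_leaderP; split=> // v zv; have [] := uv v.
Qed.

End arrow_graph.

Section hitting.
Implicit Types (f g : steps_space) (x y z : int).

(** Storing the predecessor of each step makes all steps positive, with no
exceptional null set to carry along. *)
Definition jumps f : int -> nat := fun z => (f z).+1.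

Definition descend f x z := if x <= z then parent (jumps f) z else z.

(** The site at which the ancestral line of z enters the sites below x. Each step is
at least one, so the number of iterations is large enough, and the extra ones
have no effect. *)
Definition hit f x z := iter `|z - x|.+1 (descend f x) z.

(** Induction along an ancestral line, until it falls below x. *)
Lemma below_ind x (Pr : int -> Prop) :
  (forall z, z < x -> Pr z) ->
  (forall z, x <= z -> (forall u, u < z -> Pr u) -> Pr z) -> forall z, Pr z.
Proof.
move=> P0 PS.
suff H n z : z < x + n%:Z -> Pr z by move=> z; apply: (H `|z - x|.+1); lia.
elim: n z => [z zx|n IH z zx]; first by apply: P0; lia.
have [xz|] := leP x z; last exact: P0.
by apply: PS => // u uz; apply: IH; lia.
Qed.

Lemma descend_below f x z : z < x -> descend f x z = z.
Proof. by rewrite /descend leNgt => ->. Qed.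

Lemma iter_descend_below f x n z : z < x -> iter n (descend f x) z = z.
Proof. by move=> zx; elim: n => //= n ->; exact: descend_below. Qed.

Lemma iter_descend_lt f x n z :
  z < x + n%:Z -> iter n (descend f x) z < x.
Proof.
elim: n z => [|n IH] z zx; first by rewrite /=; lia.
rewrite iterSr; apply: IH; rewrite /descend /parent /jumps.
by case: ifP; lia.
Qed.

Lemma hitE f x n z : z < x + n%:Z -> hit f x z = iter n (descend f x) z.
Proof.
move=> zn; rewrite /hit; set m := `|z - x|.+1.
have zm : z < x + m%:Z by rewrite /m; lia.
have H i j : z < x + i%:Z ->
    iter (i + j) (descend f x) z = iter i (descend f x) z.
  by move=> zi; rewrite addnC iterD iter_descend_below//; exact: iter_descend_lt.
by rewrite -(H m n zm) addnC (H n m zn).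
Qed.

Lemma hit_lt f x z : hit f x z < x.
Proof. by apply: iter_descend_lt; lia. Qed.

Lemma hit_below f x z : z < x -> hit f x z = z.
Proof. by move=> zx; rewrite (hitE f (n := 0))//; lia. Qed.

Lemma hit_above f x z : x <= z -> hit f x z = hit f x (parent (jumps f) z).
Proof.
move=> xz; have -> : parent (jumps f) z = descend f x z by rewrite /descend xz.
have lt2 : z < x + `|z - x|.+2%:Z by lia.
have lt1 : descend f x z < x + `|z - x|.+1%:Z.
  by rewrite /descend xz /parent /jumps; lia.
by rewrite (hitE f lt2) (hitE f lt1) iterSr.
Qed.

Lemma parent_lt f z : parent (jumps f) z < z.
Proof. by rewrite /parent /jumps; lia. Qed.

Lemma hit_hit f x y z : y <= x -> hit f y (hit f x z) = hit f y z.
Proof.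
move=> yx; elim/(below_ind (x := x)): z => z zx; first by rewrite (hit_below f zx).
move=> IH; rewrite (hit_above f zx) (IH _ (parent_lt f z)).
by rewrite [in RHS]hit_above// (le_trans yx).
Qed.

Lemma hit_congr_above f g x z :
  (forall u, x <= u -> f u = g u) -> hit f x z = hit g x z.
Proof.
move=> fg; elim/(below_ind (x := x)): z => z zx; first by rewrite !hit_below.
move=> IH; rewrite !(hit_above _ zx) IH ?parent_lt//.
by rewrite /parent /jumps fg.
Qed.

Lemma hit_congr_below f g x y z : (forall u, u < x -> f u = g u) ->
  z < x -> hit f y z = hit g y z.
Proof.
move=> fg; elim/(below_ind (x := y)): z => z zy; first by rewrite !hit_below.
move=> IH zx; rewrite !(hit_above _ zy) IH ?parent_lt//; last first.
  exact: lt_trans (parent_lt f z) zx.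
by rewrite /parent /jumps fg.
Qed.

Lemma iter_parent_le f n z : iter n (parent (jumps f)) z <= z.
Proof.
by elim: n => //= n IH; apply: le_trans IH; apply/ltW/parent_lt.
Qed.

Lemma hit_iter_parent f x n z : x <= iter n (parent (jumps f)) z ->
  hit f x z = hit f x (iter n (parent (jumps f)) z).
Proof.
elim: n z => // n IH z; rewrite iterSr => H.
rewrite -IH//; apply: hit_above; apply: (le_trans H).
apply: (le_trans (iter_parent_le f n _)); exact/ltW/parent_lt.
Qed.

Lemma hit_last_ancestor f x z :
  is_last_ancestor_below (jumps f) x z (hit f x z).
Proof.
elim/(below_ind (x := x)): z => z zx.
  rewrite hit_below//; split=> //; first by exists 0%N.
  by move=> v [n ->] _; exact: iter_parent_le.
move=> IH; rewrite hit_above//; have [[n Hn] H2 H3] := IH _ (parent_lt f z).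
split=> //; first by exists n.+1; rewrite iterSr.
move=> v [[|m] ->] vx; first by move: vx; rewrite /= ltNge zx.
by apply: H3 => //; exists m; rewrite iterSr.
Qed.

Lemma last_ancestor_belowE f x z : last_ancestor_below (jumps f) x z = hit f x z.
Proof.
apply: xget_unique; first exact: hit_last_ancestor.
move=> w [w1 w2 w3]; have [h1 h2 h3] := hit_last_ancestor f x z.
by apply/eqP; rewrite eq_le h3// w3.
Qed.

Definition linked f z w := component (jumps f) z w.

Lemma linked_hit f x z : linked f z (hit f x z).
Proof.
by have [[n ->] _ _] := hit_last_ancestor f x z; exact: component_iter.
Qed.

Lemma linkedP f z w : linked f z w <-> exists x, hit f x z = hit f x w.
Proof.
split=> [/componentP[n [m nm]]|[x xzw]]; last first.
  apply: (component_trans (linked_hit f x z)); rewrite xzw.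
  exact/component_sym/linked_hit.
exists (iter n (parent (jumps f)) z).
by rewrite (@hit_iter_parent _ _ n)// nm -hit_iter_parent.
Qed.

Lemma hit_eq_le f x y z w : y <= x -> hit f x z = hit f x w ->
  hit f y z = hit f y w.
Proof. by move=> yx e; rewrite -(hit_hit f z yx) e hit_hit. Qed.

(** The graph with the arrows of f below x and those of g from x on. *)
Definition splice_at x f g : steps_space := splice (fun z => z < x) f g.

Lemma hit_splice_at x f g z : hit (splice_at x f g) x z = hit g x z.
Proof. by apply: hit_congr_above => u; rewrite /splice_at /splice ltNge => ->. Qed.

Lemma hit_splice_at_below x y f g z : z < x ->
  hit (splice_at x f g) y z = hit f y z.
Proof.
by move=> zx; apply: (hit_congr_below (x := x)) => // u; rewrite /splice_at /splice => ->.
Qed.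

(** The Markov property at level x, for a fixed graph. *)
Lemma hit_splice_at_le x y f g z : y <= x ->
  hit (splice_at x f g) y z = hit f y (hit g x z).
Proof.
move=> yx; rewrite -(hit_hit (splice_at x f g) z yx) hit_splice_at.
exact/hit_splice_at_below/hit_lt.
Qed.

(** Connections are decided by what the ancestral lines do below x. *)
Lemma linked_splice_at x f g z w : linked (splice_at x f g) z w <->
  linked f (hit g x z) (hit g x w).
Proof.
split=> /linkedP[y yzw]; apply/linkedP; last first.
  exists (Order.min x y); rewrite !hit_splice_at_le ?ge_min ?lexx//.
  by apply: hit_eq_le yzw; rewrite ge_min lexx orbT.
exists (Order.min x y); rewrite -!hit_splice_at_le ?ge_min ?lexx//.
by apply: hit_eq_le yzw; rewrite ge_min lexx orbT.
Qed.

Lemma measurable_jumps : measurable_fun setT (jumps : steps_space -> steps_space).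
Proof.
by apply: measurable_to_family => z; exact: (dmeas_comp S (dmeas_coord z)).
Qed.

Lemma dmeas_hit x z : discrete_mfun (fun f : steps_space => hit f x z).
Proof.
rewrite /hit; elim: (_.+1) => [|n IH]; first exact: dmeas_cst.
have md u : discrete_mfun (fun f : steps_space => descend f x u).
  rewrite /descend; case: (x <= u); last exact: dmeas_cst.
  exact: (dmeas_comp (fun n : nat => u - n.+1%:Z) (dmeas_coord u)).
exact: (dmeas_bind IH md).
Qed.

Lemma dmeas_fst_hit d (T : measurableType d) x z :
  discrete_mfun (fun p : steps_space * T => hit p.1 x z).
Proof. exact: (measurable_dmeas measurable_fst (dmeas_hit x z)). Qed.

Lemma dmeas_hits x V : discrete_mfun (fun f : steps_space => map (hit f x) V).
Proof. exact: (dmeas_map V (dmeas_hit x)). Qed.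

Lemma measurable_linked z w : measurable [set f | linked f z w].
Proof.
have := measurable_jumps measurableT (Y := [set k | component k z w]).
by rewrite setTI; apply; exact: measurable_component.
Qed.

End hitting.

Section raw_graph.

Lemma ancestor_measurable z w :
  measurable [set k : steps_space | ancestor k z w].
Proof.
apply: measurable_exists => n.
exact: (dmeas_iter_parent n z [set u | w = u]).
Qed.

Lemma is_last_measurable x z w :
  measurable [set k : steps_space | is_last_ancestor_below k x z w].
Proof.
rewrite (_ : mkset _ = [set k : steps_space | ancestor k z w] `&`
  ([set k | w < x] `&` [set k | forall v,
    (~` [set k : steps_space | ancestor k z v] `|` [set k | v < x -> v <= w]) k])).
  apply: measurableI; first exact: ancestor_measurable.
  apply: measurableI.
    exact: (@dmeas_cst _ steps_space _ (w < x) [set b | is_true b]).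
  apply: measurable_forall => v; apply: measurableU.
    by apply: measurableC; exact: ancestor_measurable.
  exact: (@dmeas_cst _ steps_space _ v [set v | v < x -> v <= w]).
apply/seteqP; split=> k /=.
  move=> [a b c]; split=> //; split=> // v.
  by have [av|] := pselect (ancestor k z v); [right; exact: c|left].
by move=> [a [b c]]; split=> // v av; have [] := c v.
Qed.

(** The fiber over z also contains the graphs in which no ancestor of z is below x,
where the value is the default. *)
Lemma dmeas_last_ancestor x z :
  discrete_mfun (fun k : steps_space => last_ancestor_below k x z).
Proof.
apply: dmeas_fib => u.
pose L k := [set w | is_last_ancestor_below k x z w].
have Luniq (k : int -> nat) v w : L k v -> L k w -> v = w.
  by move=> [a1 b1 c1] [a2 b2 c2]; apply/eqP; rewrite eq_le c1// c2.
rewrite (_ : _ @^-1` _ = [set k : steps_space | is_last_ancestor_below k x z u] `|`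
  ([set k : steps_space | forall v, (~` [set k : steps_space |
      is_last_ancestor_below k x z v]) k] `&` [set k | u = z])).
  apply: measurableU; first exact: is_last_measurable.
  apply: measurableI; last exact: (@dmeas_cst _ steps_space _ u [set u | u = z]).
  apply: measurable_forall => v.
  by apply: measurableC; exact: is_last_measurable.
apply/seteqP; split=> k /=.
  rewrite /last_ancestor_below; case: xgetP => [w -> Lw <-|nL <-]; first by left.
  by right.
move=> [Lu|[nL ->]]; first exact: (xget_unique z Lu (fun w Lw => Luniq k _ _ Lw Lu)).
by rewrite /last_ancestor_below; case: xgetP => // w _ /nL.
Qed.

Lemma resample_jumps f x (s : config) :
  resample (jumps f) x s = (fun z => s (hit f x z)).
Proof.
apply/funext => z; rewrite /resample last_ancestor_belowE.
by case: leP => // zx; rewrite hit_below.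
Qed.

Lemma measurable_resample_raw x (s : config) (B : set (spins_on [set z | x <= z])) :
  measurable B -> measurable [set k : steps_space | B (resample k x s)].
Proof.
move=> mB.
have mr : measurable_fun setT
    (fun k : steps_space => resample k x s : spins_on [set z | x <= z]).
  apply: measurable_to_spins => z /= xz; rewrite /resample xz.
  exact: (dmeas_comp s (dmeas_last_ancestor x z)).
by have := mr measurableT B mB; rewrite setTI.
Qed.

End raw_graph.

(** * Bounded harmonic functions of a random walk *)

Section liouville.
Variables (R : realType) (mu : probability nat R).
Implicit Types (phi psi h : int -> R) (z : int).

Definition bounded_seq phi := exists M, forall z, `|phi z| <= M.

Definition step_avg phi z : R := \int[mu]_j phi (z - j%:Z).

Lemma bmf_step phi z : bounded_seq phi -> bounded_mfun (fun j : nat => phi (z - j%:Z)).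
Proof. by move=> [M phiM]; split=> //; exists M. Qed.

Lemma bounded_step_avg phi : bounded_seq phi -> bounded_seq (step_avg phi).
Proof.
move=> bphi; have [M phiM] := bphi; exists M => z.
have fMM j : - M <= phi (z - j%:Z) <= M by rewrite -ler_norml.
rewrite ler_norml; apply/andP; split.
  rewrite -(Ex_cst mu (- M)); apply: Ex_le; [exact: bmf_cst|exact: bmf_step|].
  by move=> j; have /andP[] := fMM j.
rewrite -(Ex_cst mu M); apply: Ex_le; [exact: bmf_step|exact: bmf_cst|].
by move=> j; have /andP[] := fMM j.
Qed.

Lemma bounded_iter_avg phi n : bounded_seq phi ->
  bounded_seq (iter n step_avg phi).
Proof. by move=> bphi; elim: n => //= n; exact: bounded_step_avg. Qed.

Lemma boundedB phi psi : bounded_seq phi -> bounded_seq psi ->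
  bounded_seq (fun z => phi z - psi z).
Proof.
by move=> [M HM] [N HN]; exists (M + N) => z; rewrite (le_trans (ler_normB _ _))// lerD.
Qed.

Lemma boundedM phi psi : bounded_seq phi -> bounded_seq psi ->
  bounded_seq (fun z => phi z * psi z).
Proof.
by move=> [M HM] [N HN]; exists (M * N) => z; rewrite normrM ler_pM.
Qed.

Lemma boundedX2 phi : bounded_seq phi -> bounded_seq (fun z => phi z ^+ 2).
Proof. by move=> b; have := boundedM b b; under eq_fun do rewrite -expr2. Qed.

Lemma bounded_shift phi (j : nat) : bounded_seq phi ->
  bounded_seq (fun z => phi (z - j%:Z)).
Proof. by move=> [M HM]; exists M. Qed.

Lemma step_avgB phi psi z : bounded_seq phi -> bounded_seq psi ->
  step_avg (fun z => phi z - psi z) z = step_avg phi z - step_avg psi z.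
Proof. by move=> *; rewrite /step_avg ExB//; exact: bmf_step. Qed.

Lemma iter_avgB phi psi n z : bounded_seq phi -> bounded_seq psi ->
  iter n step_avg (fun z => phi z - psi z) z =
  iter n step_avg phi z - iter n step_avg psi z.
Proof.
move=> bphi bpsi; elim: n z => //= n IH z.
by rewrite (funext IH) step_avgB//; exact: bounded_iter_avg.
Qed.

Lemma step_avg_le phi psi : bounded_seq phi -> bounded_seq psi ->
  (forall z, phi z <= psi z) -> forall z, step_avg phi z <= step_avg psi z.
Proof. by move=> b1 b2 le12 z; apply: Ex_le => //; exact: bmf_step. Qed.

Lemma iter_avg_le phi psi n : bounded_seq phi -> bounded_seq psi ->
  (forall z, phi z <= psi z) ->
  forall z, iter n step_avg phi z <= iter n step_avg psi z.
Proof.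
move=> b1 b2 le12; elim: n => //= n IH.
by apply: step_avg_le => //; exact: bounded_iter_avg.
Qed.

Lemma iter_avgZ c phi n z : bounded_seq phi ->
  iter n step_avg (fun z => c * phi z) z = c * iter n step_avg phi z.
Proof.
move=> b; elim: n z => //= n IH z; rewrite (funext IH) /step_avg ExZ//.
exact/bmf_step/bounded_iter_avg.
Qed.

(** The mean gain of h ^+ 2 in one step of the walk, when h is harmonic (energyE). *)
Definition energy h z := \int[mu]_j (h (z - j%:Z) - h z) ^+ 2.

Section harmonic_function.
Variable h : int -> R.
Hypotheses (bh : bounded_seq h) (hh : forall z, h z = step_avg h z).

Let b2 : bounded_seq (fun z => h z ^+ 2) := boundedX2 bh.

Lemma energyE z : energy h z = step_avg (fun z => h z ^+ 2) z - h z ^+ 2.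
Proof.
have bs := bmf_step z bh.
have bc : bounded_mfun (fun j : nat => (h z) ^+ 2) by exact: bmf_cst.
have be : bounded_mfun (fun j : nat => (h (z - j%:Z)) ^+ 2) by exact: bmfX.
rewrite /energy (eq_Ex mu (g := fun j : nat =>
  (h (z - j%:Z) ^+ 2 - (2 * h z) * h (z - j%:Z)) + h z ^+ 2)); last first.
  by move=> j; ring.
have bz : bounded_mfun (fun j : nat => 2 * h z * h (z - j%:Z)).
  by apply: bmfM => //; exact: bmf_cst.
rewrite ExD//; last exact: bmfB.
rewrite ExB// ExZ// Ex_cst.
by have := hh z; rewrite /step_avg => <-; ring.
Qed.

Lemma sum_energy n z :
  \sum_(0 <= i < n) iter i step_avg (energy h) z =
  iter n step_avg (fun z => h z ^+ 2) z - h z ^+ 2.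
Proof.
elim: n => [|n IH]; first by rewrite big_geq//= subrr.
rewrite big_nat_recr//= {}IH (funext energyE) iter_avgB//; last exact: bounded_step_avg.
by rewrite -iterSr iterS /=; ring.
Qed.

(** The energies add up along the walk to at most the supremum of h ^+ 2, so their
means cannot all exceed e. *)
Lemma energy_decays z (e : R) : 0 < e ->
  exists n, iter n step_avg (energy h) z <= e.
Proof.
move=> e0; apply: contrapT => /forallNP H.
have [M hM] := bounded_iter_avg 0 b2.
(* The first n energies sum to at least n * e. *)
have lt n : n%:R * e <= M.
  have leM : iter n step_avg (fun z => h z ^+ 2) z <= M.
    have itM k u : M = iter k step_avg (fun=> M) u.
      by elim: k u => //= k IH u; rewrite /step_avg -(funext IH) Ex_cst.
    rewrite {1}(itM n z); apply: iter_avg_le => //; first by exists `|M|.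
    by move=> u; exact: le_trans (ler_norm _) (hM u).
  apply: le_trans leM; rewrite -[leRHS]subr0.
  apply: (@le_trans _ _ (iter n step_avg (fun z => h z ^+ 2) z - h z ^+ 2)).
    rewrite -sum_energy; elim: n => [|n IH]; first by rewrite mul0r big_geq.
    rewrite big_nat_recr//= -natr1 mulrDl mul1r lerD//.
    by have /negP := H n; rewrite -ltNge => /ltW.
  by rewrite lerB// sqr_ge0.
have M0 : 0 <= M by have := lt 0%N; rewrite mul0r.
have := lt (Num.truncn (M / e)).+1; rewrite leNgt -ltr_pdivrMr//.
by rewrite truncnS_gt.
Qed.

(** The increment D of h by the step j is harmonic, since averaging commutes with
translations, so D ^+ 2 is at most its mean after n steps of the walk. But
mu [set j] * D ^+ 2 is one term of the energy, whose mean after n steps is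
arbitrarily small for some n. *)
Lemma step_period (j : nat) z : mu [set j] != 0%E -> h (z - j%:Z) = h z.
Proof.
move=> muj; pose D z := h (z - j%:Z) - h z.
have bD : bounded_seq D by apply: boundedB => //; exact: bounded_shift.
have bD2 := boundedX2 bD.
have DW u : D u = step_avg D u.
  rewrite /D step_avgB// -?hh//; last exact: bounded_shift.
  congr (_ - _); rewrite hh /step_avg; apply: eq_Ex => i.
  by congr (h _); lia.
have D2W n u : D u ^+ 2 <= iter n step_avg (fun z => D z ^+ 2) u.
  elim: n u => // n IH u; rewrite iterS.
  apply: (@le_trans _ _ (step_avg (fun z => D z ^+ 2) u)).
    by rewrite DW; apply: sqr_Ex_le; exact: bmf_step.
  by apply: step_avg_le => //; exact: bounded_iter_avg.
pose c := fine (mu [set j]).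
have c0 : 0 < c.
  rewrite lt_neqAle fine_ge0// andbT eq_sym -eqe fineK ?fin_num_measure//.
have cD u : c * D u ^+ 2 <= energy h u.
  rewrite /c -(Ex_indic mu (A := [set j]))// mulrC.
  rewrite -(ExZ mu _ (bmf_indic R (A := [set j]) _))//.
  have bs := bmfB (bmf_step u bh) (bmf_cst nat (h u)).
  apply: Ex_le; [|exact: bmfX|].
    by apply: bmfM; [exact: bmf_cst|exact: bmf_indic].
  move=> i; rewrite indicE; case: (boolP (i \in _)) => [|_]; last first.
    by rewrite mulr0 sqr_ge0.
  by rewrite inE => /= ->; rewrite mulr1.
have be : bounded_seq (energy h).
  by rewrite (funext energyE); apply: boundedB => //; exact: bounded_step_avg.
have D0 : D z ^+ 2 <= 0.
  apply/ler_addgt0Pl => e e0; rewrite addr0.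
  have [n Hn] := energy_decays z (mulr_gt0 c0 e0).
  rewrite -(ler_pM2l c0); apply: le_trans Hn.
  apply: (@le_trans _ _ (c * iter n step_avg (fun z => D z ^+ 2) z)).
    by rewrite ler_pM2l.
  rewrite -iter_avgZ//; apply: iter_avg_le => //.
  by apply: boundedM => //; exists `|c|.
have /eqP : D z ^+ 2 == 0 by rewrite eq_le D0 sqr_ge0.
by move/eqP; rewrite sqrf_eq0 subr_eq0 => /eqP.
Qed.

(** The periods of h contain the support of mu. Division with remainder shows that
the least positive period divides all of them, so it is 1. *)
Lemma bounded_harmonic_cst : is_gcd (law_support mu) 1 -> forall z, h z = h 0.
Proof.
move=> [_ gcd1].
pose per n := `[< forall z, h (z - n%:Z) = h z >].
(* per n states that n is a period of h. *)
have perP n : law_support mu n -> per n.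
  by move=> sn; apply/asboolP => z; exact: step_period.
have perM n i : per n -> per (i * n)%N.
  move=> /asboolP pn; apply/asboolP; elim: i => [|i IH] z.
    by rewrite mul0n subr0.
  by rewrite mulSn -[RHS]pn -[RHS]IH; congr (h _); lia.
(* If 0 were the only period, 0 would divide the support, hence 1. *)
have ex0 : exists n, per n && (0 < n)%N.
  apply: contrapT => /forallNP H.
  suff : (0 %| 1)%N by rewrite dvd0n.
  apply: gcd1 => n /perP pn; rewrite dvd0n -leqn0 leqNgt.
  by apply/negP => n0; apply: (H n); rewrite pn n0.
have [e /andP[pe e0] emin] := ex_minnP ex0.
have e1 : e = 1%N.
  apply/eqP; rewrite -dvdn1; apply: gcd1 => n /perP pn.
  rewrite /dvdn -leqn0 leqNgt; apply/negP => r0.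
  have : per (n %% e)%N.
    apply/asboolP => z; move: (perM _ (n %/ e)%N pe) pn => /asboolP pq /asboolP pn.
    rewrite -[LHS]pq -[RHS]pn; congr (h _).
    by have := divn_eq n e; lia.
  move=> pr; have := emin (n %% e)%N; rewrite pr r0 => /(_ isT).
  by rewrite leqNgt ltn_mod e0.
move: pe; rewrite e1 => /asboolP p1 {e e0 emin e1}.
have up n : h n%:Z = h 0.
  by elim: n => // n IH; rewrite -IH -[LHS]p1; congr (h _); lia.
have down n : h (- n%:Z) = h 0.
  by elim: n => [|n IH]; [rewrite oppr0|rewrite -IH -[RHS]p1; congr (h _); lia].
move=> z; have [z0|/ltW z0] := leP 0 z.
  by rewrite -(gez0_abs z0) up.
by rewrite -[z]opprK -(lez0_abs z0) down.
Qed.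

End harmonic_function.
End liouville.

(** * Functions harmonic for coalescing ancestral lines *)

Section walks.
Variables (R : realType) (Q : probability steps_space R).
Hypothesis Qindep : forall (F : seq int) (B : int -> set nat), uniq F ->
  Q [set f | forall i, i \in F -> B i (f i)] =
  (\prod_(i <- F) Q [set f | B i (f i)])%E.

(** The arrows from x on and those below x can be sampled independently. *)
Lemma Ex_splice_at x (h : steps_space -> R) : bounded_mfun h ->
  \int[Q]_f h f = \int[Q]_g \int[Q]_f h (splice_at x f g).
Proof.
move=> bh; rewrite (Ex_splice Qindep (fun z => x <= z) bh).
apply: eq_Ex => g; apply: eq_Ex => f; congr h; apply/funext => z.
by rewrite /splice_at /splice ltNge; case: (x <= z).
Qed.

Lemma bmf_hit (phi : int -> R) x z : (forall u, 0 <= phi u <= 1) ->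
  bounded_mfun (fun f => phi (hit f x z)).
Proof. by move=> /unit_bounded; exact: (dmeas_bmf (dmeas_hit x z)). Qed.

Lemma bmf_hits (phi : seq int -> R) x V : (forall u, 0 <= phi u <= 1) ->
  bounded_mfun (fun f => phi (map (hit f x) V)).
Proof. by move=> /unit_bounded; exact: (dmeas_bmf (dmeas_hits x V)). Qed.

Lemma dmeas_snd_hits x V :
  discrete_mfun (fun p : steps_space * steps_space => map (hit p.2 x) V).
Proof. exact: (measurable_dmeas measurable_snd (dmeas_hits x V)). Qed.

Lemma bmf_hit2 (phi : int -> seq int -> R) x y u V :
  (forall u V, 0 <= phi u V <= 1) ->
  bounded_mfun (fun p : steps_space * steps_space => phi (hit p.1 y u) (map (hit p.2 x) V)).
Proof.
move=> p01.
have := dmeas2 pair (@dmeas_fst_hit _ _ y u) (dmeas_snd_hits x V).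
move=> /(dmeas_bmf (f := fun w : int * seq int => phi w.1 w.2)); apply.
exact: unit_bounded.
Qed.

Lemma Ex_markov (phi : int -> R) x y z : (forall u, 0 <= phi u <= 1) -> y <= x ->
  \int[Q]_f phi (hit f y z) = \int[Q]_g \int[Q]_f phi (hit f y (hit g x z)).
Proof.
move=> p01 yx; rewrite (Ex_splice_at x (bmf_hit y z p01)).
by apply: eq_Ex => g; apply: eq_Ex => f; rewrite hit_splice_at_le.
Qed.

Definition meeting u (V : seq int) : set steps_space :=
  [set f | exists2 v, v \in V & linked f u v].

Definition meet_prob u V : R := \int[Q]_f \1_(meeting u V) f.

Lemma measurable_meeting u V : measurable (meeting u V).
Proof.
rewrite (_ : meeting u V = [set f | exists v,
    ((if v \in V then setT else set0) `&` [set f | linked f u v]) f]).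
  apply: measurable_exists => v; apply: measurableI; first by case: ifP.
  exact: measurable_linked.
apply/seteqP; split=> f /=.
  by move=> [v vV uv]; exists v; rewrite vV; split.
by move=> [v]; case: ifP => [vV [_ uv]|_ []//]; exists v.
Qed.

Lemma bmf_meeting u V : bounded_mfun (\1_(meeting u V) : steps_space -> R).
Proof. by apply: bmf_indic; exact: measurable_meeting. Qed.

Lemma meet_prob_unit u V : 0 <= meet_prob u V <= 1.
Proof.
apply: Ex_unit; first exact: bmf_meeting.
by move=> f; rewrite indicE; case: (_ \in _); rewrite ?lexx ?ler01.
Qed.

Lemma meet_prob1 u V : u \in V -> meet_prob u V = 1.
Proof.
move=> uV; rewrite -[RHS](Ex_cst Q); apply: eq_Ex => f.
rewrite indicE mem_set//; exists u => //; exact: component_refl.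
Qed.

(** Running all lines down to level x does not change which of them are connected. *)
Lemma meet_prob_markov x u V :
  meet_prob u V = \int[Q]_g meet_prob (hit g x u) (map (hit g x) V).
Proof.
rewrite [LHS](Ex_splice_at x); last exact: bmf_meeting.
apply: eq_Ex => g; apply: eq_Ex => f; rewrite !indicE; congr (nat_of_bool _)%:R.
apply/idP/idP; rewrite !inE => -[v vV].
  move=> /linked_splice_at uv; exists (hit g x v) => //.
  by apply/mapP; exists v.
case/mapP: vV => v' v'V -> uv; exists v' => //.
exact/linked_splice_at.
Qed.

Definition merged_by x u V : R := \int[Q]_f (hit f x u \in map (hit f x) V)%:R.

Lemma bmf_merged x u V : bounded_mfun (fun f => (hit f x u \in map (hit f x) V)%:R : R).
Proof.
have := dmeas_hits x (u :: V).
move=> /(dmeas_bmf (f := fun w => (head 0 w \in behead w)%:R : R)); apply.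
by apply: unit_bounded => w; case: (_ \in _); rewrite ?lexx ?ler01.
Qed.

(** Connected lines have the same entry point below every low enough level. *)
Lemma merged_by_cvg u V :
  merged_by (- n%:Z) u V @[n --> \oo] --> meet_prob u V.
Proof.
apply: (Ex_cvg_eventually (M := 1)).
- by move=> n; exact: bmf_merged.
- by move=> n f; case: (_ \in _); rewrite ?normr1 ?normr0.
move=> f; rewrite indicE; case: (boolP (f \in _)) => [|nf].
  rewrite inE => -[v vV /linkedP[x xuv]]; exists `|x|%N => n xn.
  suff -> : hit f (- n%:Z) u \in map (hit f (- n%:Z)) V by [].
  by apply/mapP; exists v => //; apply: hit_eq_le xuv; lia.
exists 0%N => n _; case: (boolP (_ \in _)) => // /mapP[v vV uv]; exfalso.
move/negP: nf; apply; rewrite inE; exists v => //; apply/linkedP.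
by exists (- n%:Z).
Qed.

(** What is used of the function that maps V to the probability of ones V. *)
Record spin_function (g : seq int -> R) : Prop := SpinFunction {
  sf_unit : forall V, 0 <= g V <= 1;
  sf_nil : g [::] = 1;
  sf_mem : forall V W, V =i W -> g V = g W }.

(** The Gibbs condition read on the events ones V (gibbsP). *)
Definition coalescing_harmonic (g : seq int -> R) :=
  forall x V, g V = \int[Q]_f g (map (hit f x) V).

(** The line of u is run down to level y, independently of V. *)
Definition far_spin (g : seq int -> R) y u V := \int[Q]_f g (hit f y u :: V).

Section gibbs_spin_function.
Variable g : seq int -> R.
Hypotheses (sg : spin_function g) (hg : coalescing_harmonic g).

Let g01 : forall V, 0 <= g V <= 1 := sf_unit sg.

Lemma far_spin_unit y u V : 0 <= far_spin g y u V <= 1.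
Proof. by apply: Ex_unit => //; apply: (bmf_hit (phi := fun u => g (u :: V))). Qed.

Lemma far_spin_harmonic_tail x y u V : y <= x ->
  far_spin g y u V = \int[Q]_w far_spin g y u (map (hit w x) V).
Proof.
move=> yx.
have -> : far_spin g y u V =
    \int[Q]_f \int[Q]_w g (hit f y u :: map (hit w x) V).
  apply: eq_Ex => f; rewrite [LHS](hg x); apply: eq_Ex => w /=.
  by rewrite [hit w x _]hit_below// (lt_le_trans (hit_lt _ _ _) yx).
exact: (Ex_swap Q Q (bmf_hit2 x y u V (phi := fun u V => g (u :: V)) _)).
Qed.

Lemma far_spin_harmonic_head x y u V : y <= x ->
  far_spin g y u V = \int[Q]_w far_spin g y (hit w x u) V.
Proof. by move=> yx; apply: (Ex_markov (phi := fun u => g (u :: V))). Qed.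

(* The two expressions solve the same recursion until u meeting V. *)
(** By induction on a level x above all the sites. To lower x by one, either the line
of u or the lines of V leave the site x, unless u is a member of V, in which
case the right-hand side is 1. So g, far_spin and meet_prob obey the same
averaging equations, and far_spin is g as soon as u is below y. *)
Lemma far_spin_error y u V : `|g (u :: V) - far_spin g y u V| <= meet_prob u V.
Proof.
have [n Hn] : exists n : nat, forall z, z \in u :: V -> z < y + n%:Z.
  elim: (u :: V) => [|v W [n Hn]]; first by exists 0%N.
  exists (maxn n `|v - y|.+1) => z; rewrite inE => /orP[/eqP ->|/Hn]; lia.
elim: n => [|n IH] in u V Hn *.
  have uy : u < y by have := Hn u; rewrite inE eqxx => /(_ isT); lia.
  rewrite (_ : far_spin g y u V = g (u :: V)).
    by rewrite subrr normr0; have /andP[] := meet_prob_unit u V.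
  rewrite /far_spin -[RHS](Ex_cst Q); apply: eq_Ex => f.
  by rewrite hit_below.
have /andP[gf0 gf1] := far_spin_unit y u V.
have /andP[g0 g1] := g01 (u :: V).
have [uV|uV] := boolP (u \in V).
  by rewrite meet_prob1// ler_norml; apply/andP; split; lra.
pose x := y + n%:Z.
have yx : y <= x by rewrite /x; lia.
have farE : far_spin g y u V =
    \int[Q]_w far_spin g y (hit w x u) (map (hit w x) V).
  have [ux|xu] := ltP u x.
    rewrite (far_spin_harmonic_tail u V yx); apply: eq_Ex => w.
    by rewrite (hit_below w ux).
  rewrite (far_spin_harmonic_head u V yx); apply: eq_Ex => w.
  congr (far_spin _ _ _ _); rewrite -[LHS]map_id; apply/eq_in_map => v vV.
  rewrite hit_below//; have uu := Hn u; have vv := Hn v.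
  have : v != u by apply: contra uV => /eqP <-.
  move: uu vv; rewrite !inE eqxx vV orbT => /(_ isT) uu /(_ isT) vv.
  by rewrite /x in xu *; lia.
have bg := bmf_hits x (u :: V) g01.
have bf : bounded_mfun (fun w => far_spin g y (hit w x u) (map (hit w x) V)).
  apply: (bmf_hits x (u :: V) (phi := fun W => far_spin g y (head 0 W) (behead W))).
  by move=> W; exact: far_spin_unit.
rewrite farE (hg x (u :: V)) -ExB//= (meet_prob_markov x).
apply: Ex_norm_le; first exact: bmfB.
  apply: (bmf_hits x (u :: V) (phi := fun W => meet_prob (head 0 W) (behead W))).
  by move=> W; exact: meet_prob_unit.
by move=> w; apply: IH => z; rewrite -map_cons => /mapP[v _ ->]; exact: hit_lt.
Qed.

(** Far down its ancestral line, the spin of u is +1 with probability p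
independently of the spins of V. *)
Definition asymptotic_density p := forall u V,
  far_spin g (- n%:Z) u V @[n --> \oo] --> p * g V.

Lemma density_error p u V : asymptotic_density p ->
  `|g (u :: V) - p * g V| <= meet_prob u V.
Proof.
move=> tp.
have c : `|g (u :: V) - far_spin g (- n%:Z) u V| @[n --> \oo] -->
    `|g (u :: V) - p * g V|.
  by apply: cvg_norm; apply: cvgB; [exact: cvg_cst|exact: tp].
rewrite -(cvg_lim (@Rhausdorff R) c); apply: limr_le.
  by apply/cvg_ex; eexists; exact: c.
by apply: nearW => n; exact: far_spin_error.
Qed.

End gibbs_spin_function.

(** By induction on the size of V. Both functions are averaged over the entry points
below a level x. If the line of u has merged with one of V by then, the
induction hypothesis applies; otherwise both functions are within meet_prob of
the same value. The probability of meeting only below x vanishes as x tends to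
-oo. *)
Lemma spin_function_unique g g' p :
  spin_function g -> coalescing_harmonic g -> asymptotic_density g p ->
  spin_function g' -> coalescing_harmonic g' -> asymptotic_density g' p ->
  g = g'.
Proof.
move=> sg hg tg sg' hg' tg'; apply/funext => V.
have [n] := ubnP (size V); elim: n V => // n IH [|u V].
  by rewrite !sf_nil.
rewrite ltnS => Vn.
suff H : `|g (u :: V) - g' (u :: V)| <= 0.
  by apply/eqP; rewrite -subr_eq0 -normr_le0.
have Hx x : `|g (u :: V) - g' (u :: V)| <=
    2 * (meet_prob u V - merged_by x u V).
  have bm : bounded_mfun (fun w => meet_prob (hit w x u) (map (hit w x) V)).
    apply: (bmf_hits x (u :: V) (phi := fun W => meet_prob (head 0 W) (behead W))).
    by move=> W; exact: meet_prob_unit.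
  have be := bmf_merged x u V.
  have bg := bmf_hits x (u :: V) (sf_unit sg).
  have bg' := bmf_hits x (u :: V) (sf_unit sg').
  rewrite (hg x) (hg' x) -ExB// (meet_prob_markov x) -ExB// -ExZ; last exact: bmfB.
  apply: Ex_norm_le; first exact: bmfB.
    by apply: bmfM; [exact: bmf_cst|exact: bmfB].
  move=> w /=; set a := hit w x u; set W := map _ _.
  have gW : g W = g' W by apply: IH; rewrite size_map.
  have [aW|aW] := boolP (a \in W).
    have aWW : a :: W =i W.
      by move=> z; rewrite inE; case: eqP => // ->; rewrite aW.
    rewrite (sf_mem sg aWW) (sf_mem sg' aWW) gW subrr normr0.
    by rewrite meet_prob1// subrr mulr0.
  have e1 := density_error sg hg a W tg.
  have e2 := density_error sg' hg' a W tg'.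
  rewrite subr0; move: e1 e2; rewrite gW !ler_norml.
  by move=> /andP[? ?] /andP[? ?]; apply/andP; split; lra.
have c : 2 * (meet_prob u V - merged_by (- n%:Z) u V) @[n --> \oo] --> (0 : R).
  rewrite -(mulr0 2) -(subrr (meet_prob u V)).
  apply: cvgM; first exact: cvg_cst.
  by apply: cvgB; [exact: cvg_cst|exact: merged_by_cvg].
rewrite -(cvg_lim (@Rhausdorff R) c); apply: limr_ge.
  by apply/cvg_ex; eexists; exact: c.
by apply: nearW => m; exact: Hx.
Qed.

End walks.

(** * Two independent ancestral lines *)

Section two_walks.
Variables (R : realType) (mu : probability nat R) (Q : probability steps_space R).
Hypothesis Qindep : forall (F : seq int) (B : int -> set nat), uniq F ->
  Q [set f | forall i, i \in F -> B i (f i)] =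
  (\prod_(i <- F) Q [set f | B i (f i)])%E.
Hypothesis Qmarg : forall z (A : set nat), Q [set f | A (jumps f z)] = mu A.

Lemma Ex_first_step (phi : int -> R) a : (forall u, 0 <= phi u <= 1) ->
  \int[Q]_f phi (hit f a a) = step_avg mu phi a.
Proof.
move=> p01.
have mj : measurable_fun setT (fun f : steps_space => jumps f a).
  by move=> _ A _; rewrite setTI; exact: (dmeas_comp S (dmeas_coord a)).
have bphi := bmf_step a (unit_bounded p01).
rewrite /step_avg -(@eq_Ex_measure _ _ _ (law Q mj) mu); last first.
  by move=> A _; rewrite lawE -(Qmarg a).
rewrite (Ex_law Q mj bphi); apply: eq_Ex => f.
by rewrite hit_above// hit_below//; exact: parent_lt.
Qed.

Lemma coalescing_harmonic_step g a : spin_function g ->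
  coalescing_harmonic Q g ->
  g [:: a] = step_avg mu (fun z => g [:: z]) a.
Proof.
move=> sg hg; rewrite (hg a) -Ex_first_step// => u.
exact: sf_unit sg _.
Qed.

Definition pair_meet a b : R := meet_prob Q a [:: b].

Lemma pair_meet_unit a b : 0 <= pair_meet a b <= 1.
Proof. exact: meet_prob_unit. Qed.

Lemma meeting1 a b : meeting a [:: b] = [set f | linked f a b].
Proof.
apply/seteqP; split=> f /=; first by move=> [v]; rewrite inE => /eqP ->.
by move=> ab; exists b => //; rewrite inE.
Qed.

Lemma pair_meetE a b : pair_meet a b = fine (Q [set f | linked f a b]).
Proof.
rewrite /pair_meet /meet_prob Ex_indic; last exact: measurable_meeting.
by rewrite meeting1.
Qed.

Lemma pair_meetC a b : pair_meet a b = pair_meet b a.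
Proof.
rewrite !pair_meetE; congr (fine (Q _)).
by apply/seteqP; split=> f; exact: component_sym.
Qed.

Lemma pair_meet1 a : pair_meet a a = 1.
Proof. by apply: meet_prob1; rewrite inE. Qed.

Lemma pair_meet_markov x a b :
  pair_meet a b = \int[Q]_g pair_meet (hit g x a) (hit g x b).
Proof. exact: (meet_prob_markov Qindep). Qed.

Lemma bmf_pair2 (phi : int -> int -> R) x y a b :
  (forall u v, 0 <= phi u v <= 1) ->
  bounded_mfun (fun p : steps_space * steps_space => phi (hit p.1 y a) (hit p.2 x b)).
Proof.
move=> p01; apply: (bmf_hit2 x y a [:: b] (phi := fun u V => phi u (head 0 V))).
by move=> u V; exact: p01.
Qed.

(** Two lines run independently down to level y, and are then continued in a common
graph. *)
Definition indep_meet y a b : R :=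
  \int[Q]_f \int[Q]_g pair_meet (hit f y a) (hit g y b).

Lemma indep_meet_tail_unit y a b : 0 <= \int[Q]_g pair_meet a (hit g y b) <= 1.
Proof.
apply: Ex_unit => [|g]; last exact: pair_meet_unit.
by apply: (bmf_hit (phi := pair_meet a)) => u; exact: pair_meet_unit.
Qed.

Lemma indep_meet_unit y a b : 0 <= indep_meet y a b <= 1.
Proof.
apply: Ex_unit => [|f]; last exact: indep_meet_tail_unit.
apply: (bmf_hit (phi := fun a => \int[Q]_g pair_meet a (hit g y b))) => u.
exact: indep_meet_tail_unit.
Qed.

Lemma indep_meetC y a b : indep_meet y a b = indep_meet y b a.
Proof.
apply: etrans (Ex_swap Q Q (bmf_pair2 y y a b pair_meet_unit)) _.
by apply: eq_Ex => f; apply: eq_Ex => g; exact: pair_meetC.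
Qed.

Lemma indep_meet_markov x y a b : y <= x ->
  indep_meet y a b = \int[Q]_w indep_meet y (hit w x a) b.
Proof.
apply: (Ex_markov Qindep (phi := fun a => \int[Q]_g pair_meet a (hit g y b))).
by move=> u; exact: indep_meet_tail_unit.
Qed.

Lemma indep_meet_markov2 x y a b : y <= x ->
  indep_meet y a b =
  \int[Q]_f \int[Q]_g indep_meet y (hit f x a) (hit g x b).
Proof.
move=> yx; rewrite (indep_meet_markov a b yx); apply: eq_Ex => f.
rewrite indep_meetC (indep_meet_markov b _ yx).
by apply: eq_Ex => g; rewrite indep_meetC.
Qed.

Lemma bmf_hit_pair (phi : int -> int -> R) x a b :
  (forall u v, 0 <= phi u v <= 1) ->
  bounded_mfun (fun f => phi (hit f x a) (hit f x b)).
Proof.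
move=> p01.
exact: (bmf_hits x [:: a; b] (phi := fun W => phi (nth 0 W 0) (nth 0 W 1))).
Qed.

(** Same induction on levels as for far_spin_error. The only difference between the
two sides arises when the two lines are at the same site: there they have met on
the right-hand side, but may separate again on the left-hand side. *)
Lemma indep_meet_le y a b : indep_meet y a b <= pair_meet a b.
Proof.
have [n [an bn]] : exists n : nat, a < y + n%:Z /\ b < y + n%:Z.
  by exists (maxn `|a - y| `|b - y|).+1; split; lia.
elim: n => [|n IH] in a b an bn *.
  rewrite addr0 in an bn.
  rewrite le_eqVlt; apply/orP; left; apply/eqP.
  rewrite -[RHS](Ex_cst Q); apply: eq_Ex => f.
  rewrite -[RHS](Ex_cst Q); apply: eq_Ex => g.
  by rewrite !hit_below.
have [->|ab] := eqVneq a b.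
  by rewrite pair_meet1; have /andP[] := indep_meet_unit y b b.
wlog ba : a b an bn ab / b < a.
  move=> W; have [] := ltgtP b a => [||ba]; first exact: W.
    move=> ltab; rewrite indep_meetC pair_meetC; apply: W => //.
    by rewrite eq_sym.
  by rewrite ba eqxx in ab.
pose x := y + n%:Z.
have bx : b < x by rewrite /x; lia.
have yx : y <= x by rewrite /x; lia.
rewrite (indep_meet_markov a b yx) (pair_meet_markov x).
apply: Ex_le.
- apply: (bmf_hit (phi := fun a => indep_meet y a b)) => u.
  exact: indep_meet_unit.
- exact: (bmf_hit_pair x a b pair_meet_unit).
- by move=> w; rewrite (hit_below w bx); apply: IH => //; exact: hit_lt.
Qed.

Lemma indep_meet_mono x y a b : y <= x -> indep_meet y a b <= indep_meet x a b.
Proof.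
move=> yx; rewrite (indep_meet_markov2 a b yx).
have b1 := bmf_pair2 x x a b (indep_meet_unit y).
have b2 := bmf_pair2 x x a b pair_meet_unit.
apply: Ex_le; [exact: (bmf_Ex2 Q Q b1)|exact: (bmf_Ex2 Q Q b2)|move=> f].
apply: Ex_le; [exact: (bmf_section1 f b1)|exact: (bmf_section1 f b2)|move=> g].
exact: indep_meet_le.
Qed.

(** The probability that two independent lines have common sites arbitrarily far
down. *)
Definition tail_meet a b : R := limn (fun n => indep_meet (- n%:Z) a b).

Lemma indep_meet_cvg a b : indep_meet (- n%:Z) a b @[n --> \oo] --> tail_meet a b.
Proof.
apply: nonincreasing_is_cvgn.
  by move=> m n mn; apply: indep_meet_mono; lia.
exists 0 => _ [n _ <-]; have /andP[] := indep_meet_unit (- n%:Z) a b => //.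
Qed.

Lemma tail_meet_unit a b : 0 <= tail_meet a b <= 1.
Proof.
apply/andP; split.
  apply: limr_ge; first by apply/cvg_ex; eexists; exact: indep_meet_cvg.
  by apply: nearW => n; have /andP[] := indep_meet_unit (- n%:Z) a b.
apply: limr_le; first by apply/cvg_ex; eexists; exact: indep_meet_cvg.
by apply: nearW => n; have /andP[] := indep_meet_unit (- n%:Z) a b.
Qed.

Lemma tail_meet_le a b : tail_meet a b <= pair_meet a b.
Proof.
apply: limr_le; first by apply/cvg_ex; eexists; exact: indep_meet_cvg.
by apply: nearW => n; exact: indep_meet_le.
Qed.

Lemma tail_meetC a b : tail_meet a b = tail_meet b a.
Proof.
have c : indep_meet (- n%:Z) a b @[n --> \oo] --> tail_meet b a.
  have e n : (0 <= n)%N -> indep_meet (- n%:Z) a b = indep_meet (- n%:Z) b a.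
    by move=> _; exact: indep_meetC.
  exact: (cvg_near_eq e (@indep_meet_cvg b a)).
exact: (cvg_lim (@Rhausdorff R) c).
Qed.

Lemma tail_meet_harmonic a b :
  tail_meet a b = step_avg mu (fun z => tail_meet z b) a.
Proof.
have [_ c] : bounded_mfun (fun j : nat => tail_meet (a - j%:Z) b) /\
    \int[mu]_j indep_meet (- n%:Z) (a - j%:Z) b @[n --> \oo] -->
    \int[mu]_j tail_meet (a - j%:Z) b.
  apply: (@Ex_cvg _ _ _ mu _ _ 1) => //.
    move=> n j; have /andP[h0 h1] := indep_meet_unit (- n%:Z) (a - j%:Z) b.
    by rewrite ger0_norm.
  by move=> j; exact: indep_meet_cvg.
have c' : indep_meet (- n%:Z) a b @[n --> \oo] -->
    step_avg mu (fun z => tail_meet z b) a.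
  suff e n : (`|a| <= n)%N -> indep_meet (- n%:Z) a b =
      \int[mu]_j indep_meet (- n%:Z) (a - j%:Z) b by exact: (cvg_near_eq e c).
  move=> an; have na : - n%:Z <= a by lia.
  rewrite (indep_meet_markov a b na).
  rewrite (Ex_first_step (phi := fun u => indep_meet (- n%:Z) u b))// => u.
  exact: indep_meet_unit.
exact: (cvg_lim (@Rhausdorff R) c').
Qed.

Hypothesis mu_gcd : is_gcd (law_support mu) 1.

(** It is a bounded harmonic function of each of the two starting points. *)
Lemma tail_meet_cst a b : tail_meet a b = tail_meet 0 0.
Proof.
have H z w : tail_meet z w = tail_meet 0 w.
  apply: (bounded_harmonic_cst (mu := mu) (h := fun z => tail_meet z w)) => //.
    by apply: unit_bounded => u; exact: tail_meet_unit.
  by move=> u; exact: tail_meet_harmonic.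
by rewrite H tail_meetC H.
Qed.

(** Let t be the constant value of tail_meet. The function pair_meet - t is
nonnegative, preserved in mean by two coalescing lines, and equal to 1 - t when
they agree. Hence pair_meet - t >= (1 - t) * pair_meet, that is
t * (1 - pair_meet) <= 0. *)
Lemma tail_meet0 : (exists a b, pair_meet a b < 1) ->
  forall a b, indep_meet (- n%:Z) a b @[n --> \oo] --> (0 : R).
Proof.
move=> [a [b ab1]] c e.
suff <- : tail_meet c e = 0 by exact: indep_meet_cvg.
rewrite tail_meet_cst; set t := tail_meet 0 0.
have t01 : 0 <= t <= 1 by exact: tail_meet_unit.
have tq u v : t <= pair_meet u v by rewrite /t -(tail_meet_cst u v) tail_meet_le.
have key n : (1 - t) * merged_by Q (- n%:Z) a [:: b] <= pair_meet a b - t.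
  set x := - n%:Z.
  have bm := bmf_merged R x a [:: b].
  have bp := bmf_hit_pair x a b pair_meet_unit.
  have -> : pair_meet a b - t =
      \int[Q]_g (pair_meet (hit g x a) (hit g x b) - t).
    by rewrite ExB ?Ex_cst -?pair_meet_markov//; exact: bmf_cst.
  rewrite -ExZ//.
  apply: Ex_le; [|by apply: bmfB => //; exact: bmf_cst|].
    by apply: bmfM => //; exact: bmf_cst.
  move=> f; rewrite inE; case: eqP => [->|_]; first by rewrite pair_meet1 mulr1.
  by rewrite mulr0 subr_ge0.
have lim1 : (1 - t) * merged_by Q (- n%:Z) a [:: b] @[n --> \oo] -->
    (1 - t) * pair_meet a b.
  by apply: cvgM; [exact: cvg_cst|exact: merged_by_cvg].
have : (1 - t) * pair_meet a b <= pair_meet a b - t.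
  rewrite -(cvg_lim (@Rhausdorff R) lim1); apply: limr_le.
    by apply/cvg_ex; eexists; exact: lim1.
  by apply: nearW => n; exact: key.
move: t01 => /andP[t0 t1] H; apply/eqP; rewrite eq_le t0 andbT.
by nra.
Qed.

End two_walks.

(** * The law of the steps *)

Section canonical_law.
Variables (R : realType) (mu : probability nat R) (d : measure_display)
  (Omega : measurableType d) (P : probability Omega R).
Hypothesis mu_pos : mu [set 0%N] = 0%E.

Lemma mu_pred (A : set nat) : mu [set n | A n.-1.+1] = mu A.
Proof.
have H B : mu B = mu (B `\ 0%N).
  rewrite (measureDI mu (B := [set 0%N]))// [X in (_ + X)%E](_ : _ = 0%E) ?adde0//.
  apply/eqP; rewrite eq_le measure_ge0 andbT -[leRHS]mu_pos.
  by apply: le_measure; rewrite ?inE//; exact: subIsetr.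
rewrite H [RHS]H; congr (mu _); apply/seteqP; split=> -[|n] //=; tauto.
Qed.

Variable k : int -> {RV P >-> nat}.
Hypothesis hk : samples_graph mu k.

Lemma dmeas_steps z : discrete_mfun (fun w => k z w).
Proof. by move=> A; have := measurable_funPTI (k z) (Y := A); apply. Qed.

Lemma P_steps z (A : set nat) : P (k z @^-1` A) = mu A.
Proof. by rewrite -(hk.1 z A). Qed.

Lemma measurable_pred_steps :
  measurable_fun setT (fun w => (fun z => (k z w).-1) : steps_space).
Proof.
by apply: measurable_to_family => z; exact: (dmeas_comp predn (dmeas_steps z)).
Qed.

Lemma measurable_steps : measurable_fun setT (steps k : Omega -> steps_space).
Proof. by apply: measurable_to_family => z; exact: dmeas_steps. Qed.

Lemma mutually_independent_seq (I : choiceType) (S : I -> set_system Omega)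
    (F : seq I) (A : I -> set Omega) : mutually_independent P S -> uniq F ->
  (forall i, i \in F -> S i (A i)) ->
  P [set w | forall i, i \in F -> A i w] = (\prod_(i <- F) P (A i))%E.
Proof.
move=> indep uF SA.
have := indep [fset i in F]%fset A; rewrite (_ : \bigcap_(i in _) _ =
    [set w | forall i, i \in F -> A i w]); last first.
  apply/seteqP; split=> w /= H i.
    by move=> iF; apply: H => /=; rewrite in_fset.
  by rewrite /= in_fset; exact: H.
move=> ->; last by move=> i; rewrite in_fset; exact: SA.
by apply: perm_big; apply: uniq_perm => // i; rewrite in_fset.
Qed.

Lemma steps_indep (F : seq int) (B : int -> set nat) : uniq F ->
  P [set w | forall i, i \in F -> B i (k i w)] =
  (\prod_(i <- F) P (k i @^-1` B i))%E.
Proof.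
move=> uF; apply: (mutually_independent_seq (A := fun i => k i @^-1` B i) hk.2) => //.
by move=> i _; exists (B i) => //; rewrite setTI.
Qed.

Definition step_law : probability steps_space R := law P measurable_pred_steps.

Lemma step_law_marginal z (A : set nat) : step_law [set f | A (jumps f z)] = mu A.
Proof.
rewrite /step_law lawE -[RHS]mu_pred -(P_steps z).
by congr (P _).
Qed.

Lemma step_law_indep (F : seq int) (B : int -> set nat) : uniq F ->
  step_law [set f | forall i, i \in F -> B i (f i)] =
  (\prod_(i <- F) step_law [set f | B i (f i)])%E.
Proof.
move=> uF; rewrite /step_law lawE.
exact: (@steps_indep F (fun i => [set n | B i n.-1]) uF).
Qed.

(** As mu gives no mass to 0, the graph of k has the law of a graph of jumps. *)
Lemma step_lawE (A : set steps_space) : measurable A ->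
  P [set w | A (steps k w)] = step_law [set f | A (jumps f)].
Proof.
move: A; apply: (@eq_probability_family _ _
  (law P measurable_steps) (law step_law measurable_jumps)).
move=> _ [F [B ->]]; rewrite (lawE _ measurable_steps) (lawE _ measurable_jumps).
have H : [set w : Omega | forall i, i \in undup F -> B i (k i w)] =
    [set w : Omega | forall i, i \in F -> B i (k i w)].
  by apply/seteqP; split=> w /= H i; have := H i; rewrite mem_undup.
transitivity (\prod_(i <- undup F) P (k i @^-1` B i))%E.
  by rewrite -steps_indep ?undup_uniq// H.
transitivity (\prod_(i <- undup F) step_law [set f | B i (jumps f i)])%E.
  by apply: eq_bigr => i _; rewrite P_steps step_law_marginal.
have -> := esym (@step_law_indep (undup F) (fun i => [set n | B i n.+1]) (undup_uniq F)).
by congr (step_law _); apply/seteqP; split=> f /= Hf i; have := Hf i; rewrite mem_undup.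
Qed.

End canonical_law.

(** * Gibbs measures as coalescing-harmonic functions *)

Section gibbs_harmonic.
Variables (R : realType) (lam : probability config R).

Definition spin_prob V : R := fine (lam (ones V)).

Lemma spin_probE V : (spin_prob V)%:E = lam (ones V).
Proof. by rewrite fineK_prob//; exact: ones_config. Qed.

Lemma spin_prob_function : spin_function spin_prob.
Proof.
split.
- move=> V; rewrite -!lee_fin spin_probE measure_ge0 /=.
  exact: (probability_le1 _ (ones_config V)).
- rewrite /spin_prob (_ : ones [::] = setT); last exact/seteqP.
  by rewrite probability_setT.
- move=> V W VW; congr (fine (lam _)).
  by apply/seteqP; split=> s; rewrite /ones/= (eq_all_r VW).
Qed.

Variable Q : probability steps_space R.

Definition gibbs_kernel x (s : config) (B : set config) : \bar R :=
  Q [set f | B (resample (jumps f) x s)].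

Lemma measurable_shift x : measurable_fun setT
  (fun p : steps_space * config => (fun z => p.2 (hit p.1 x z)) : config).
Proof.
apply: measurable_to_spins => z _.
have mh := dmeas_fst_hit x z.
have mF u : discrete_mfun (fun p : steps_space * config => p.2 u).
  exact: (measurable_dmeas measurable_snd (dmeas_spin (S := setT) I)).
exact: (dmeas_bind (mh _ _) mF).
Qed.

Lemma measurable_shift_below x : measurable_fun setT
  (fun p : steps_space * spins_on [set z | z < x] =>
     (fun z => p.2 (hit p.1 x z)) : spins_on [set z | x <= z]).
Proof.
apply: measurable_to_spins => z _.
have mF u : discrete_mfun (fun p : steps_space * spins_on [set z | z < x] =>
    if u < x then p.2 u else false).
  case: (boolP (u < x)) => ux; last exact: dmeas_cst.
  exact: (measurable_dmeas measurable_snd (dmeas_spin (S := [set z | z < x]) ux)).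
have := dmeas_bind (@dmeas_fst_hit _ _ x z) mF; congr discrete_mfun.
by apply/funext => p; rewrite hit_lt.
Qed.

Lemma shift_ones_law x V :
  pprod Q lam [set p | ones V (fun z => p.2 (hit p.1 x z))] =
  (\int[Q]_f spin_prob (map (hit f x) V))%:E.
Proof.
have mO := measurable_shift x measurableT (ones_config V).
rewrite setTI in mO; rewrite pprod12// EFin_Ex; last first.
  by apply: bmf_hits => W; exact: sf_unit spin_prob_function W.
apply: eq_integral => f _; rewrite spin_probE; congr (lam _).
by apply/seteqP; split=> s; rewrite /ones/= all_map.
Qed.

(** The event ones V is the intersection of an event about the sites below x and an
event about the other ones. *)
Lemma conditional_laws_harmonic :
  (forall x, is_conditional_law lam [set z | z < x] [set z | x <= z]
    (gibbs_kernel x)) -> coalescing_harmonic Q spin_prob.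
Proof.
move=> G x V; apply: EFin_inj; rewrite -shift_ones_law spin_probE.
have mO := measurable_shift x measurableT (ones_config V).
rewrite setTI in mO; rewrite pprod21//.
pose V1 := [seq z <- V | z < x]; pose V2 := [seq z <- V | x <= z].
have VE : ones V = ones V1 `&` ones V2.
  rewrite -ones_cat; apply/seteqP; split=> s; rewrite /ones/= => /allP H; apply/allP.
    by move=> z; rewrite mem_cat !mem_filter => /orP[|] /andP[_]; exact: H.
  move=> z zV; apply: H; rewrite mem_cat !mem_filter zV !andbT.
  by have [] := leP x z; rewrite ?orbT.
rewrite [in LHS]VE (G x).2; last 2 first.
- by apply: ones_measurable => z; rewrite mem_filter => /andP[].
- by apply: ones_measurable => z; rewrite mem_filter => /andP[].
rewrite integral_mkcond; apply: eq_integral => s _; rewrite /restrict.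
case: ifPn => [|/negP].
  rewrite inE => s1; rewrite /gibbs_kernel; congr (Q _).
  apply/seteqP; split=> f /=; rewrite resample_jumps VE => H.
    split=> //; apply/allP => z zV; rewrite hit_below.
      by move/allP : s1; exact.
    by move: zV; rewrite mem_filter => /andP[].
  by case: H.
rewrite inE => ns1; rewrite (_ : [set _ | _] = set0) ?measure0//.
apply/seteqP; split=> f //=; rewrite VE => -[H _]; apply: ns1.
apply/allP => z zV; move/allP: H => /(_ z zV); rewrite hit_below//.
by move: zV; rewrite mem_filter => /andP[].
Qed.

(** Harmonicity says that resampling from x on preserves the probability of the
events ones V, hence preserves lam. Since it leaves the spins below x unchanged,
it can be restricted to any event about these spins. The kernel is measurable
for the spins below x because an entry point is always below x. *)
Lemma harmonic_conditional_laws : coalescing_harmonic Q spin_prob ->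
  forall x, is_conditional_law lam [set z | z < x] [set z | x <= z]
    (gibbs_kernel x).
Proof.
move=> hg x; split=> [B mB|A B mA mB].
  have mS := @measurable_shift_below x measurableT _ mB.
  rewrite setTI in mS.
  have := measurable_fun_ysection Q mS; congr measurable_fun.
  apply/funext => s; rewrite /gibbs_kernel /=; congr (Q _).
  by apply/seteqP; split=> f; rewrite /ysection/= resample_jumps inE.
have mA' : measurable (A : set config) by exact: measurable_spins_sub mA.
have mB' : measurable (B : set config) by exact: measurable_spins_sub mB.
have mAB : measurable (A `&` B : set config) by exact: measurableI.
have mX := measurable_shift x measurableT mAB; rewrite setTI in mX.
have -> : lam (A `&` B) = pprod Q lam
    [set p | (A `&` B) (fun z => p.2 (hit p.1 x z))].
  have := @eq_probability_spins R setT lam (law (pprod Q lam) (measurable_shift x)).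
  move=> /(_ _ (A `&` B) mAB); rewrite (lawE _ (measurable_shift x)); apply.
  move=> V _; rewrite (lawE _ (measurable_shift x)).
  by rewrite [RHS]shift_ones_law -hg spin_probE.
rewrite pprod21// [RHS]integral_mkcond; apply: eq_integral => s _; rewrite /restrict.
have Aloc f : A (fun z => s (hit f x z)) <-> A s.
  by split; apply: (spins_on_local mA) => z /= zx; rewrite hit_below.
case: ifPn => [|/negP]; rewrite inE => As.
  rewrite /gibbs_kernel; congr (Q _).
  apply/seteqP; split=> f /=; rewrite resample_jumps; first by case.
  by move=> ?; split=> //; apply/Aloc.
rewrite (_ : [set _ | _] = set0) ?measure0//.
by apply/seteqP; split=> f //= [/Aloc].
Qed.

End gibbs_harmonic.

Lemma conditional_law_congr (R : realType) (lam : probability config R) S1 S2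
    (kappa kappa' : config -> set config -> \bar R) :
  (forall s (B : set (spins_on S2)), measurable B -> kappa s B = kappa' s B) ->
  is_conditional_law lam S1 S2 kappa -> is_conditional_law lam S1 S2 kappa'.
Proof.
move=> kk [m1 m2]; split=> [B mB|A B mA mB].
  have := m1 B mB; congr measurable_fun.
  by apply/funext => s; exact: kk.
by rewrite m2//; apply: eq_integral => s _; exact: kk.
Qed.

Section gibbs_characterization.
Variables (R : realType) (mu : probability nat R) (d : measure_display)
  (Omega : measurableType d) (P : probability Omega R).
Hypothesis mu_pos : mu [set 0%N] = 0%E.
Variable k : int -> {RV P >-> nat}.
Hypothesis hk : samples_graph mu k.

Lemma gibbsP (lam : probability config R) :
  gibbs k lam <-> coalescing_harmonic (step_law k) (spin_prob lam).
Proof.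
have E x s (B : set (spins_on [set z | x <= z])) : measurable B ->
    P [set w | B (resample (steps k w) x s)] = gibbs_kernel (step_law k) x s B.
  move=> mB; apply: (step_lawE mu_pos hk (A := [set k | B (resample k x s)])).
  exact: measurable_resample_raw.
split=> [G|H x].
  apply: conditional_laws_harmonic => x.
  by apply: conditional_law_congr (G x) => s B; exact: E.
apply: conditional_law_congr (harmonic_conditional_laws H x) => s B mB.
exact/esym/E.
Qed.

End gibbs_characterization.

(** * Colouring the components by independent coins *)

(** The number of distinct values of a map depends only on its kernel. *)
Lemma size_undup_map (I T T' : eqType) (a : I -> T) (b : I -> T') V :
  (forall i j, (a i == a j) = (b i == b j)) ->
  size (undup (map a V)) = size (undup (map b V)).
Proof.
move=> ab; elim: V => //= i V IH.
have -> : (a i \in map a V) = (b i \in map b V).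
  apply/mapP/mapP => -[j jV /eqP].
    by rewrite ab => /eqP; exists j.
  by rewrite -ab => /eqP; exists j.
by case: ifP => //= _; rewrite IH.
Qed.

Section component_coins.
Variables (R : realType) (mu : probability nat R) (d : measure_display)
  (Omega : measurableType d) (P : probability Omega R).
Hypothesis mu_pos : mu [set 0%N] = 0%E.
Variable k : int -> {RV P >-> nat}.
Hypothesis hk : samples_graph mu k.
Variables (p : R) (c : int -> {RV P >-> bool}).
Hypotheses (p01 : 0 <= p <= 1) (hc : component_coins k p c).

Local Notation Q := (step_law k).

Lemma dmeas_coin z : discrete_mfun (fun w => c z w).
Proof. by move=> A; have := measurable_funPTI (c z) (Y := A); apply. Qed.

Lemma measurable_coloring :
  measurable_fun setT (component_coloring k c : Omega -> config).
Proof.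
apply: measurable_to_spins => z _.
have mh : discrete_mfun (fun w => vertex_leader (steps k w) z).
  exact: (measurable_dmeas (measurable_steps k) (dmeas_leader z)).
exact: (dmeas_bind mh dmeas_coin).
Qed.

Definition coin_colored_law : probability config R := law P measurable_coloring.

Lemma coin_colored_lawE A : coin_colored_law A = lambda_law k c A.
Proof. by []. Qed.

Definition joint_sample (w : Omega) : nat_family (int + int)%type :=
  fun i => match i with inl z => k z w | inr z => nat_of_bool (c z w) end.

Lemma measurable_joint : measurable_fun setT joint_sample.
Proof.
apply: measurable_to_family => -[z|z]; first exact: dmeas_steps.
exact: (dmeas_comp nat_of_bool (dmeas_coin z)).
Qed.

Definition joint_law := law P measurable_joint.

Lemma joint_indep (F : seq (int + int)) (B : int + int -> set nat) : uniq F ->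
  joint_law [set f | forall i, i \in F -> B i (f i)] =
  (\prod_(i <- F) joint_law [set f | B i (f i)])%E.
Proof.
move=> uF; rewrite /joint_law lawE.
apply: (mutually_independent_seq hc.2 (A := fun i => [set w | B i (joint_sample w i)])) => //.
move=> [z|z] _; first by exists (B (inl z)) => //; rewrite setTI.
exists [set b | B (inr z) (nat_of_bool b)] => //.
by rewrite setTI.
Qed.

Lemma coins_true (L : seq int) :
  joint_law [set h | forall i, i \in L -> h (inr i) = 1%N] =
  (p ^+ size (undup L))%:E.
Proof.
rewrite (_ : [set _ | _] = [set h : nat_family (int + int)%type |
    forall i, i \in [seq inr z : int + int | z <- undup L] -> [set 1%N] (h i)]).
  transitivity (\prod_(i <- [seq inr z : int + int | z <- undup L])
      joint_law [set f | f i = 1%N])%E.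
    apply: (@joint_indep _ (fun=> [set 1%N])).
    by rewrite map_inj_uniq ?undup_uniq// => a b [].
  rewrite big_map (eq_bigr (fun=> p%:E)) => [|z _].
    by elim: (undup L) => [|z l IH]; rewrite ?big_nil ?big_cons ?IH /= ?exprS ?EFinM.
  rewrite /joint_law lawE -(hc.1 z); congr (P _); apply/seteqP.
  by split=> w /=; case: (c z w).
apply/seteqP; split=> h /=.
  by move=> H _ /mapP[z zL ->]; apply: H; rewrite -mem_undup.
by move=> H i iL; apply: H; apply/mapP; exists i => //; rewrite mem_undup.
Qed.

Definition num_components (kk : int -> nat) V :=
  size (undup (map (vertex_leader kk) V)).

Lemma bmf_num_components V :
  bounded_mfun (fun kk : steps_space => p ^+ num_components kk V).
Proof.
have := dmeas_map V dmeas_leader.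
move=> /(dmeas_bmf (f := fun L => p ^+ size (undup L))); apply.
apply: unit_bounded => L.
by have /andP[p0 p1] := p01; rewrite exprn_ge0//= exprn_ile1.
Qed.

Definition graph_part (h : nat_family (int + int)%type) : steps_space :=
  fun z => h (inl z).

Lemma measurable_graph_part : measurable_fun setT graph_part.
Proof. by apply: measurable_to_family => z; exact: (dmeas_coord (inl z)). Qed.

(** Graph and coins are decoupled by splicing; given the graph, the spins of V are
the coins of the distinct leaders of V. *)
Lemma coin_colored_ones V : coin_colored_law (ones V) =
  (\int[Q]_f (p ^+ num_components (jumps f) V))%:E.
Proof.
pose A := [set h : nat_family (int + int)%type |
  forall z, z \in V -> h (inr (vertex_leader (graph_part h) z)) = 1%N].
have mA : measurable A.
  pose X (h : nat_family (int + int)%type) :=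
    [seq h (inr (vertex_leader (graph_part h) z)) | z <- V].
  have mX : discrete_mfun X.
    apply: dmeas_map => z.
    have ml : discrete_mfun (fun h => vertex_leader (graph_part h) z).
      exact: (measurable_dmeas measurable_graph_part (dmeas_leader z)).
    exact: (dmeas_bind ml (fun u => dmeas_coord (inr u))).
  rewrite (_ : A = X @^-1` [set L | all (pred1 1%N) L]); first exact: mX.
  apply/seteqP; split=> h /=; rewrite /X all_map => H.
    by apply/allP => z zV /=; apply/eqP/H.
  by move=> z zV; apply/eqP; move/allP : H => /(_ z zV).
have -> : coin_colored_law (ones V) = joint_law A.
  rewrite [LHS](lawE P measurable_coloring) [RHS](lawE P measurable_joint).
  congr (P _).
  apply/seteqP; split=> w; rewrite /ones/= /A/= /component_coloring => H.
    move=> z zV; move/allP : H => /(_ z zV).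
    by rewrite /graph_part /steps /vertex_leader => ->.
  apply/allP => z zV; have := H z zV.
  by rewrite /graph_part /steps /vertex_leader; case: (c _ _).
(* Keep the graph and resample the coins. *)
rewrite (splice_law joint_indep (fun i => if i is inl _ then true else false) mA).
have mS := measurable_splice (I := (int + int)%type)
  (fun i => if i is inl _ then true else false) measurableT (Y := A) mA.
rewrite setTI in mS; rewrite pprod12//.
transitivity (\int[joint_law]_h (p ^+ num_components (graph_part h) V))%:E.
  rewrite EFin_Ex; last exact: (bmf_comp measurable_graph_part (bmf_num_components V)).
  apply: eq_integral => h _; rewrite /num_components -coins_true.
  congr (joint_law _); apply/seteqP; split=> h' /=.
    by move=> H i /mapP[z zV ->]; exact: H.
  by move=> H z zV; apply: H; apply/mapP; exists z.
congr (_%:E); rewrite (Ex_law P measurable_joint); last first.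
  exact: (bmf_comp measurable_graph_part (bmf_num_components V)).
rewrite -(Ex_law Q measurable_jumps (bmf_num_components V)).
rewrite -(Ex_law P (measurable_steps k) (bmf_num_components V)).
apply: eq_Ex_measure => B mB; rewrite (lawE P (measurable_steps k)).
exact: (step_lawE mu_pos hk mB).
Qed.

Lemma spin_prob_coin V : spin_prob coin_colored_law V =
  \int[Q]_f (p ^+ num_components (jumps f) V).
Proof. by rewrite /spin_prob coin_colored_ones. Qed.

(** The number of components of V depends only on the entry points below x and on
the arrows below x. *)
Lemma coin_colored_harmonic : coalescing_harmonic Q (spin_prob coin_colored_law).
Proof.
move=> x V; rewrite spin_prob_coin.
rewrite (Ex_splice_at (step_law_indep hk) x (h := fun f => p ^+ num_components (jumps f) V)).
  apply: eq_Ex => g; rewrite spin_prob_coin; apply: eq_Ex => f.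
  congr (p ^+ _); rewrite /num_components -map_comp.
  apply: size_undup_map => i j; apply/eqP/eqP => /=.
    by move=> /eq_leader /linked_splice_at ?; exact/eq_leader.
  by move=> /eq_leader ?; apply/eq_leader/linked_splice_at.
exact: (bmf_comp measurable_jumps (bmf_num_components V)).
Qed.

Lemma spin_prob_coin1 u : spin_prob coin_colored_law [:: u] = p.
Proof. by rewrite spin_prob_coin -[RHS](Ex_cst Q); apply: eq_Ex => f /=. Qed.

Lemma spin_prob_coin2 u v : spin_prob coin_colored_law [:: u; v] =
  p ^+ 2 + (p - p ^+ 2) * pair_meet Q u v.
Proof.
have bm := bmf_meeting R u [:: v].
rewrite spin_prob_coin /pair_meet /meet_prob -ExZ//.
rewrite -[X in X + _](Ex_cst Q) -ExD; [|exact: bmf_cst|]; last first.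
  by apply: bmfM => //; exact: bmf_cst.
apply: eq_Ex => f; rewrite indicE /num_components/= inE.
have -> : (f \in meeting u [:: v]) = (vertex_leader (jumps f) u == vertex_leader (jumps f) v).
  rewrite meeting1; apply/idP/eqP; rewrite inE /=.
    by move=> ?; exact/eq_leader.
  by move=> /eq_leader.
by case: eqP => _ /=; ring.
Qed.

End component_coins.

(** * The conditional probability of a spin given the remote past *)

Section variance.
Variables (R : realType) (Q : probability steps_space R).
Variable lam : probability config R.
Local Notation g := (spin_prob lam).

(** Under a Gibbs measure, a version of the conditional probability that the spin of
u is +1 given the spins below y. *)
Definition far_mean y u (s : config) : R := \int[Q]_f (s (hit f y u))%:R.

Lemma bmf_spin_hit y u : bounded_mfun
  (fun p : steps_space * config => (p.2 (hit p.1 y u))%:R : R).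
Proof.
have mF v : discrete_mfun (fun p : steps_space * config => p.2 v).
  exact: (measurable_dmeas measurable_snd (dmeas_spin (S := setT) I)).
have := dmeas_bind (@dmeas_fst_hit _ _ y u) mF.
move=> /(dmeas_bmf (f := fun b : bool => b%:R : R)); apply.
by apply: unit_bounded => -[]; rewrite ?lexx ?ler01.
Qed.

Lemma bmf_far_mean y u : bounded_mfun (far_mean y u).
Proof. exact: (bmf_Ex1 Q lam (bmf_spin_hit y u)). Qed.

Lemma far_mean_unit y u s : 0 <= far_mean y u s <= 1.
Proof.
apply: Ex_unit => [|f]; first exact: (bmf_section2 s (bmf_spin_hit y u)).
by case: (s _); rewrite ?lexx ?ler01.
Qed.

Lemma Ex_far_mean y u (h : config -> R) : bounded_mfun h ->
  \int[lam]_s (far_mean y u s * h s) =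
  \int[Q]_f \int[lam]_s ((s (hit f y u))%:R * h s).
Proof.
move=> bh; have bp := bmf_spin_hit y u.
have bph : bounded_mfun (fun p : steps_space * config => (p.2 (hit p.1 y u))%:R * h p.2).
  by apply: bmfM => //; exact: (bmf_comp measurable_snd bh).
rewrite [RHS](Ex_swap Q lam bph); apply: eq_Ex => s /=.
rewrite mulrC /far_mean -ExZ; last exact: (bmf_section2 s bp).
by apply: eq_Ex => f; rewrite mulrC.
Qed.

Lemma Ex_far_mean_ones y u V :
  \int[lam]_s (far_mean y u s * \1_(ones V) s) = far_spin Q g y u V.
Proof.
rewrite Ex_far_mean; last by apply: bmf_indic; exact: ones_config.
apply: eq_Ex => f; rewrite /spin_prob -Ex_indic; last exact: ones_config.
apply: eq_Ex => s; rewrite !indicE -natrM mulnb; congr (nat_of_bool _)%:R.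
by apply/andP/idP; rewrite !inE /ones/= => /andP.
Qed.

Lemma ones1 a (s : config) : (s a)%:R = \1_(ones [:: a]) s :> R.
Proof.
by rewrite indicE; congr (nat_of_bool _)%:R; apply/idP/idP; rewrite inE /ones/= andbT.
Qed.

Lemma Ex_far_mean2 y z u :
  \int[lam]_s (far_mean z u s * far_mean y u s) =
  \int[Q]_f far_spin Q g y u [:: hit f z u].
Proof.
rewrite Ex_far_mean; last exact: bmf_far_mean.
apply: eq_Ex => f; rewrite -Ex_far_mean_ones; apply: eq_Ex => s.
by rewrite ones1 mulrC.
Qed.

(** The mean square of far_mean - p (far_varianceE), written with g alone so that it
is visibly affine in g. *)
Definition far_variance (g : seq int -> R) p y u : R :=
  \int[Q]_f far_spin Q g y u [:: hit f y u] -
  2 * p * far_spin Q g y u [::] + p ^+ 2.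

Lemma far_varianceE p y u :
  far_variance g p y u = \int[lam]_s ((far_mean y u s - p) ^+ 2).
Proof.
have bM := bmf_far_mean y u.
rewrite (eq_Ex lam (g := fun s => (far_mean y u s * far_mean y u s -
  (2 * p) * far_mean y u s) + p ^+ 2)); last by move=> s; ring.
have bMM := bmfM bM bM.
have bpM : bounded_mfun (fun s => 2 * p * far_mean y u s) by apply: bmfM => //; exact: bmf_cst.
rewrite ExD; [|exact: bmfB|exact: bmf_cst].
rewrite ExB// ExZ// Ex_cst Ex_far_mean2 /far_variance; congr (_ - _ * _ + _).
rewrite -Ex_far_mean_ones; apply: eq_Ex => s.
by rewrite indicE mem_set// mulr1.
Qed.

(** Cauchy-Schwarz, since the difference is the mean of far_mean - p on ones V. *)
Lemma far_spin_variance p y u V :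
  (far_spin Q g y u V - p * g V) ^+ 2 <= far_variance g p y u.
Proof.
have bM := bmf_far_mean y u.
have mV := ones_config V; have bV := bmf_indic R mV.
rewrite far_varianceE.
have -> : far_spin Q g y u V - p * g V =
    \int[lam]_s ((far_mean y u s - p) * \1_(ones V) s).
  rewrite -Ex_far_mean_ones /spin_prob -Ex_indic// -ExZ// -ExB.
  - by apply: eq_Ex => s; rewrite mulrBl.
  - exact: bmfM.
  - by apply: bmfM => //; exact: bmf_cst.
by apply: sqr_Ex_indic_le => //; apply: bmfB => //; exact: bmf_cst.
Qed.

Lemma far_variance_ge0 p y u : 0 <= far_variance g p y u.
Proof. exact: le_trans (sqr_ge0 _) (far_spin_variance p y u [::]). Qed.

Lemma variance_density p :
  (forall u, far_variance g p (- n%:Z) u @[n --> \oo] --> (0 : R)) ->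
  asymptotic_density Q g p.
Proof.
move=> v0 u V; apply/cvgrPdist_le => e e0.
have e20 : 0 < e ^+ 2 by rewrite exprn_gt0.
have /cvgrPdist_le /(_ _ e20) := v0 u; apply: filterS => n.
rewrite sub0r normrN ger0_norm ?far_variance_ge0// => ve.
have := le_trans (far_spin_variance p (- n%:Z) u V) ve.
set X := _ - _ => X2; have {X2}: `|X| <= e.
  by rewrite ler_norml; apply/andP; split; nra.
by rewrite /X distrC.
Qed.

End variance.

(** * Limits of weighted laws *)

Section weighted_limit.
Context d (T : measurableType d) (R : realType).
Variables (lam : probability T R) (M : nat -> T -> R).
Hypotheses (bM : forall n, bounded_mfun (M n)) (M01 : forall n x, 0 <= M n x <= 1).

Definition weighted n (A : set T) : R := \int[lam]_x (M n x * \1_A x).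

Definition wlim (A : set T) : R := limn (weighted ^~ A).

Hypothesis Mcvg : forall A, measurable A -> cvgn (weighted ^~ A).

Lemma wlim_cvg (A : set T) : measurable A ->
  weighted n A @[n --> \oo] --> wlim A.
Proof. exact: Mcvg. Qed.

Lemma bmf_weighted n (A : set T) : measurable A -> bounded_mfun (fun x => M n x * \1_A x).
Proof. by move=> mA; apply: bmfM => //; exact: bmf_indic. Qed.

Lemma wlim_ge0 (A : set T) : measurable A -> 0 <= wlim A.
Proof.
move=> mA; apply: limr_ge; first exact: Mcvg.
apply: nearW => n; apply: Ex_ge0 => x.
by rewrite mulr_ge0//; have /andP[] := M01 n x.
Qed.

Lemma wlim_le (A : set T) : measurable A -> wlim A <= fine (lam A).
Proof.
move=> mA; apply: limr_le; first exact: Mcvg.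
apply: nearW => n; rewrite -Ex_indic//.
apply: Ex_le; [exact: bmf_weighted|exact: bmf_indic|move=> x].
by rewrite ler_piMl//; have /andP[] := M01 n x.
Qed.

Lemma wlimU (A B : set T) : measurable A -> measurable B ->
  A `&` B = set0 -> wlim (A `|` B) = wlim A + wlim B.
Proof.
move=> mA mB AB.
have c : weighted n (A `|` B) @[n --> \oo] --> wlim A + wlim B.
  suff e n : (0 <= n)%N -> weighted n (A `|` B) = weighted n A + weighted n B.
    by apply: (cvg_near_eq e); apply: cvgD; exact: wlim_cvg.
  move=> _; rewrite /weighted -ExD; [|exact: bmf_weighted|exact: bmf_weighted].
  apply: eq_Ex => x; rewrite -mulrDr !indicE in_setU; congr (_ * _).
  case: (boolP (x \in A)) => xA; case: (boolP (x \in B)) => xB //=; rewrite ?addr0 ?add0r//.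
  by have : set0 x by rewrite -AB; split; exact: set_mem.
exact: (cvg_lim (@Rhausdorff R) c).
Qed.

(** The value 0 outside the measurable sets, where the limit may not exist, makes it
a nonnegative function on all sets. *)
Definition wlim_measure (A : set T) : \bar R :=
  if `[< measurable A >] then (wlim A)%:E else 0%E.

Lemma wlim_measureE (A : set T) : measurable A -> wlim_measure A = (wlim A)%:E.
Proof. by move=> mA; rewrite /wlim_measure asboolT. Qed.

Lemma wlim0 : wlim set0 = 0.
Proof.
apply/eqP; rewrite eq_le wlim_ge0// andbT.
by apply: le_trans (wlim_le measurable0) _; rewrite measure0.
Qed.

Let wlim_measure0 : wlim_measure set0 = 0%E.
Proof. by rewrite wlim_measureE// wlim0. Qed.

Let wlim_measure_ge0 A : (0 <= wlim_measure A)%E.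
Proof.
rewrite /wlim_measure; case: ifPn => // /asboolP mA.
by rewrite lee_fin wlim_ge0.
Qed.

Lemma tail_union_sum (a : set T -> R) (F : nat -> set T) n :
  (forall A B, measurable A -> measurable B -> A `&` B = set0 ->
    a (A `|` B) = a A + a B) ->
  (forall i, measurable (F i)) -> trivIset setT F ->
  a (\bigcup_i F i) = \sum_(0 <= i < n) a (F i) + a (\bigcup_(i in [set i | n <= i]%N) F i).
Proof.
move=> aU mF tF; elim: n => [|n ->].
  rewrite big_geq// add0r; congr a.
  by apply/seteqP; split=> x [i _ Fx]; exists i.
rewrite big_nat_recr//= -addrA; congr (_ + _).
rewrite -aU//; last 2 first.
- exact: bigcup_measurable.
- apply/seteqP; split=> x //= [Fn [i ni Fi]].
  by have := tF n i I I (ex_intro _ x (conj Fn Fi)) => en; rewrite /= en ltnn in ni.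
congr a; apply/seteqP; split=> x.
  move=> [i /= ni Fi]; move: ni; rewrite leq_eqVlt => /orP[/eqP ->|ni]; first by left.
  by right; exists i.
by move=> [Fn|[i /= ni Fi]]; [exists n => /=|exists i => //=; exact: ltnW].
Qed.

Lemma fine_probU (A B : set T) : measurable A -> measurable B ->
  A `&` B = set0 -> fine (lam (A `|` B)) = fine (lam A) + fine (lam B).
Proof.
by move=> mA mB AB; rewrite measureU// fineD// fin_num_measure.
Qed.

(** The limit is finitely additive and dominated by lam, so the mass it could lose
in a countable union is at most a tail of the convergent sum for lam. *)
Let wlim_measure_sigma_additive : semi_sigma_additive wlim_measure.
Proof.
move=> F mF tF mUF; rewrite wlim_measureE//.
set U := \bigcup_n F n.
have rest n := bigcup_measurable (P := [set i | n <= i]%N) (fun i _ => mF i).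
have sumE n : (\sum_(0 <= i < n) wlim_measure (F i))%E =
    (\sum_(0 <= i < n) wlim (F i))%:E.
  by rewrite -sumEFin; apply: eq_bigr => i _; rewrite wlim_measureE.
under eq_fun do rewrite sumE.
apply: cvg_EFin; first exact: nearW.
have lamc : \sum_(0 <= i < n) fine (lam (F i)) @[n --> \oo] -->
    fine (lam U).
  have c : (\sum_(0 <= i < n) fine (lam (F i)))%:E @[n --> \oo] -->
      (fine (lam U))%:E.
    rewrite fineK_prob//.
    have <- : (fun n => (\sum_(0 <= i < n) lam (F i))%E) =
        (fun n => (\sum_(0 <= i < n) fine (lam (F i)))%:E).
      by apply/funext => n; rewrite -sumEFin; apply: eq_bigr => i _; rewrite fineK_prob.
    exact: measure_semi_sigma_additive.
  exact: (fine_cvg c).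
apply: (@squeeze_cvgr _ _ _ _ (fun n => wlim U -
    (fine (lam U) - \sum_(0 <= i < n) fine (lam (F i))))
    (fun=> wlim U)).
- apply: nearW => n.
  have /= e1 := tail_union_sum n wlimU mF tF.
  have /= e2 := tail_union_sum n fine_probU mF tF.
  have /= h1 := wlim_le (rest n); have /= h2 := wlim_ge0 (rest n).
  by apply/andP; split; lra.
- have c : wlim U - (fine (lam U) - \sum_(0 <= i < n) fine (lam (F i))) @[n --> \oo]
      --> wlim U - (fine (lam U) - fine (lam U)).
    by apply: cvgB; [exact: cvg_cst|apply: cvgB; [exact: cvg_cst|exact: lamc]].
  by move: c; rewrite subrr subr0.
- exact: cvg_cst.
Qed.

HB.instance Definition _ := isMeasure.Build _ _ _ wlim_measure
  wlim_measure0 wlim_measure_ge0 wlim_measure_sigma_additive.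

Definition tilted_law : probability T R := mnormalize wlim_measure lam.

Lemma tilted_lawE (A : set T) : measurable A -> 0 < wlim setT ->
  tilted_law A = (wlim A / wlim setT)%:E.
Proof.
move=> mA w0.
transitivity ((if (wlim_measure setT == 0%E) || (wlim_measure setT == +oo%E)
    then (fun U => lam U) else
    fun U => (wlim_measure U * ((fine (wlim_measure setT))^-1)%:E)%E) A).
  by [].
by rewrite !wlim_measureE// eqe gt_eqF//= wlim_measureE// EFinM.
Qed.

End weighted_limit.

(** The sequence v decreases to a limit, so x is a Cauchy sequence. *)
Lemma cvgn_of_energy (R : realType) (x v : nat -> R) :
  (forall m n, (m <= n)%N -> (x n - x m) ^+ 2 <= v m - v n) ->
  (forall n, 0 <= v n) -> cvgn x.
Proof.
move=> xv v0.
have cv : cvgn v.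
  apply: nonincreasing_is_cvgn.
    by move=> m n /xv mn; rewrite -subr_ge0; apply: le_trans mn; exact: sqr_ge0.
  by exists 0 => _ [n _ <-].
have vl n : limn v <= v n.
  apply: nonincreasing_cvgn_ge => // m m' /xv mn.
  by rewrite -subr_ge0; apply: le_trans mn; exact: sqr_ge0.
apply: cauchy_cvg; apply/cauchy_exP => e e0.
have e20 : 0 < e ^+ 2 by rewrite exprn_gt0.
have /cvgrPdist_lt /(_ _ e20) [N _ HN] := cv.
exists (x N); exists N => // n /= Nn; rewrite /ball/=.
have := HN N (leqnn N) => /=; rewrite distrC ger0_norm ?subr_ge0// => vN.
have := xv N n Nn; have := vl n => *.
by rewrite ltr_norml; apply/andP; split; nra.
Qed.

(** * Extremal Gibbs measures *)

Section extremal_density.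
Variables (R : realType) (mu : probability nat R) (d : measure_display)
  (Omega : measurableType d) (P : probability Omega R).
Hypothesis mu_pos : mu [set 0%N] = 0%E.
Hypothesis mu_gcd : is_gcd (law_support mu) 1.
Variable k : int -> {RV P >-> nat}.
Hypothesis hk : samples_graph mu k.
Local Notation Q := (step_law k).

Lemma gibbs_density_cst lam : gibbs k lam ->
  forall z, spin_prob lam [:: z] = spin_prob lam [:: 0].
Proof.
move=> /(gibbsP mu_pos hk) hg.
apply: (bounded_harmonic_cst (mu := mu)) => //.
  by apply: unit_bounded => z; exact: sf_unit (spin_prob_function lam) _.
move=> z; apply: (coalescing_harmonic_step (step_law_marginal mu_pos hk)) => //.
exact: spin_prob_function.
Qed.

Section gibbs_far_mean.
Variable lam : probability config R.
Hypothesis Glam : gibbs k lam.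
Local Notation g := (spin_prob lam).
Let hg : coalescing_harmonic Q g := (gibbsP mu_pos hk lam).1 Glam.

(** The martingale property: the right-hand side does not depend on y. A line that is
already below z does not move when the other one is run down to y. *)
Lemma Ex_far_mean_cross y z u : z <= y ->
  \int[lam]_s (far_mean Q z u s * far_mean Q y u s) =
  \int[Q]_f g [:: u; hit f z u].
Proof.
move=> zy; rewrite Ex_far_mean2; apply: eq_Ex => f.
rewrite [RHS](hg y); apply: eq_Ex => w /=.
by rewrite [hit w y (hit f z u)]hit_below// (lt_le_trans (hit_lt _ _ _) zy).
Qed.

Let M u n := far_mean Q (- n%:Z) u.

(** The squared increments are dominated by E M_m^2 - E M_n^2, where M_n stands for
the far mean at level -n. *)
Lemma weighted_far_mean_cvg u A : measurable A -> cvgn ((weighted lam (M u)) ^~ A).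
Proof.
move=> mA; apply: (cvgn_of_energy
  (v := fun n => \int[lam]_s (M u n s * M u n s))); last first.
  by move=> n; apply: Ex_ge0 => s; rewrite -expr2 sqr_ge0.
move=> m n mn.
have bM i : bounded_mfun (M u i) by exact: bmf_far_mean.
have bmn := bmfM (bM n) (bM m).
have bmm := bmfM (bM m) (bM m).
have bnn := bmfM (bM n) (bM n).
have b2 : bounded_mfun (fun s => 2 * (M u n s * M u m s)) by apply: bmfM => //; exact: bmf_cst.
have -> : \int[lam]_s (M u m s * M u m s) - \int[lam]_s (M u n s * M u n s) =
    \int[lam]_s ((M u n s - M u m s) ^+ 2).
  have -> : \int[lam]_s ((M u n s - M u m s) ^+ 2) = \int[lam]_s
      ((M u n s * M u n s - 2 * (M u n s * M u m s)) + M u m s * M u m s).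
    by apply: eq_Ex => s; ring.
  rewrite ExD//; last exact: bmfB.
  rewrite ExB// ExZ//.
  have sub_sub2 (x y : R) : x - y = y - 2 * y + x by ring.
  have -> : \int[lam]_s (M u n s * M u m s) = \int[lam]_s (M u n s * M u n s).
    by rewrite !Ex_far_mean_cross//; lia.
  exact: sub_sub2.
rewrite /weighted -ExB; [|by apply: bmf_weighted|by apply: bmf_weighted].
have -> : \int[lam]_s (M u n s * \1_A s - M u m s * \1_A s) =
    \int[lam]_s ((M u n s - M u m s) * \1_A s).
  by apply: eq_Ex => s; rewrite mulrBl.
by apply: sqr_Ex_indic_le => //; exact: bmfB.
Qed.

End gibbs_far_mean.

End extremal_density.

Section spin_laws.
Variables (R : realType).

Lemma same_law_spin_prob (lam lam' : probability config R) :
  spin_prob lam = spin_prob lam' -> same_law lam lam'.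
Proof.
move=> e; apply: (@eq_probability_spins R setT) => V _.
by rewrite -!spin_probE e.
Qed.

Variable lam : probability config R.
Local Notation g := (spin_prob lam).

Lemma spin_prob_anti V W : {subset W <= V} -> g V <= g W.
Proof.
move=> WV; rewrite /spin_prob -!Ex_indic; try exact: ones_config.
apply: Ex_le => [||s]; try by apply: bmf_indic; exact: ones_config.
rewrite !indicE ler_nat; case: (boolP (s \in ones V)) => // sV.
rewrite mem_set//; move: sV; rewrite inE /ones/= => /allP sV.
by apply/allP => z /WV; exact: sV.
Qed.

Lemma spin_prob_cons_ge a V : g V + g [:: a] - 1 <= g (a :: V).
Proof.
have bi W : bounded_mfun (\1_(ones W) : config -> R) by apply: bmf_indic; exact: ones_config.
rewrite /spin_prob -!Ex_indic; try exact: ones_config.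
have b1 := bmfD (bi V) (bi [:: a]).
rewrite -ExD// -[X in _ - X](Ex_cst lam) -ExB//; last exact: bmf_cst.
apply: Ex_le => [||s] //; first by apply: bmfB => //; exact: bmf_cst.
rewrite !indicE; have e W : (s \in ones W) = all s W.
  by apply/idP/idP; rewrite inE.
rewrite !e /= andbT; case: (s a); case: (all s V) => /=; lra.
Qed.

End spin_laws.

Section extremal_measures.
Variables (R : realType) (mu : probability nat R) (d : measure_display)
  (Omega : measurableType d) (P : probability Omega R).
Hypothesis mu_pos : mu [set 0%N] = 0%E.
Hypothesis mu_gcd : is_gcd (law_support mu) 1.
Variable k : int -> {RV P >-> nat}.
Hypothesis hk : samples_graph mu k.
Local Notation Q := (step_law k).

(** The limits of lam weighted by far_mean and by 1 - far_mean are Gibbs after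
normalization, because far_spin is harmonic in its list argument. They form lam as
a mixture, so they are equal by extremality. When p is 0 or 1 one of them has no
mass and far_spin is computed directly. *)
Lemma extremal_density lam : extremal_gibbs k lam ->
  asymptotic_density Q (spin_prob lam) (spin_prob lam [:: 0]).
Proof.
move=> [Glam ext] u V; set g := spin_prob lam; set p := g [:: 0].
have hg : coalescing_harmonic Q g := (gibbsP mu_pos hk lam).1 Glam.
have sg : spin_function g := spin_prob_function lam.
have gp a : g [:: a] = p by exact: (gibbs_density_cst mu_pos mu_gcd hk Glam).
have /andP[p0 p1] : 0 <= p <= 1 := sf_unit sg _.
pose M n := far_mean Q (- n%:Z) u.
have bM n : bounded_mfun (M n) by exact: bmf_far_mean.
have M01 n s : 0 <= M n s <= 1 by exact: far_mean_unit.
have wE n W : weighted lam M n (ones W) = far_spin Q g (- n%:Z) u W.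
  exact: Ex_far_mean_ones.
have wT n : weighted lam M n setT = p.
  have <- : ones [::] = setT by exact/seteqP.
  by rewrite wE /far_spin -(gp u) [RHS](hg (- n%:Z)).
have [p00|pn0] := eqVneq p 0.
  rewrite p00 mul0r; suff -> : (fun n => far_spin Q g (- n%:Z) u V) = fun=> 0.
    exact: cvg_cst.
  apply/funext => n; rewrite -(Ex_cst Q 0); apply: eq_Ex => f.
  apply/eqP; rewrite eq_le; apply/andP; split.
    rewrite -p00 -(gp (hit f (- n%:Z) u)); apply: spin_prob_anti => z.
    by rewrite !inE => ->.
  by have /andP[] := sf_unit sg (hit f (- n%:Z) u :: V).
have [p11|pn1] := eqVneq p 1.
  rewrite p11 mul1r; suff -> : (fun n => far_spin Q g (- n%:Z) u V) = fun=> g V.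
    exact: cvg_cst.
  apply/funext => n; rewrite -(Ex_cst Q (g V)); apply: eq_Ex => f.
  set a := hit _ _ _; apply/eqP; rewrite eq_le; apply/andP; split.
    by apply: spin_prob_anti => z zV; rewrite inE zV orbT.
  have := spin_prob_cons_ge lam a V; rewrite -/g gp p11; lra.
have {pn0}p0 : 0 < p by rewrite lt_neqAle eq_sym pn0.
have {pn1}p1 : p < 1 by rewrite lt_neqAle pn1.
pose M' n s := 1 - M n s.
have bM' n : bounded_mfun (M' n) by apply: bmfB => //; exact: bmf_cst.
have M'01 n s : 0 <= M' n s <= 1.
  by have := M01 n s; rewrite /M' => /andP[? ?]; apply/andP; split; lra.
have cM A : measurable A -> cvgn (weighted lam M ^~ A).
  exact: (weighted_far_mean_cvg mu_pos hk Glam).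
have w'E n A : measurable A -> weighted lam M' n A = fine (lam A) - weighted lam M n A.
  move=> mA; rewrite -Ex_indic// /weighted -ExB; [|exact: bmf_indic|exact: bmf_weighted].
  by apply: eq_Ex => s; rewrite /M' mulrBl mul1r.
have cM'lim A : measurable A ->
    weighted lam M' n A @[n --> \oo] --> fine (lam A) - wlim lam M A.
  move=> mA; have e n : (0 <= n)%N -> weighted lam M' n A =
      fine (lam A) - weighted lam M n A by move=> _; exact: w'E.
  by apply: (cvg_near_eq e); apply: cvgB; [exact: cvg_cst|exact: cM].
have cM' A : measurable A -> cvgn (weighted lam M' ^~ A).
  by move=> mA; apply/cvg_ex; eexists; exact: cM'lim.
have wl'E A : measurable A -> wlim lam M' A = fine (lam A) - wlim lam M A.
  by move=> mA; exact: (cvg_lim (@Rhausdorff R) (cM'lim A mA)).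
have wlT : wlim lam M setT = p.
  rewrite /wlim (_ : (fun n => weighted lam M n setT) = fun=> p).
    exact: (cvg_lim (@Rhausdorff R) (cvg_cst p)).
  by apply/funext => n; exact: wT.
have wl'T : wlim lam M' setT = 1 - p.
  by rewrite wl'E// wlT probability_setT.
pose lam1 := tilted_law bM M01 cM; pose lam2 := tilted_law bM' M'01 cM'.
pose L W := wlim lam M (ones W).
have l1A A : measurable A -> lam1 A = (wlim lam M A / p)%:E.
  by move=> mA; rewrite -wlT; apply: tilted_lawE; rewrite ?wlT.
have l2A A : measurable A ->
    lam2 A = ((fine (lam A) - wlim lam M A) / (1 - p))%:E.
  move=> mA; rewrite -wl'E// -wl'T; apply: tilted_lawE => //.
  by rewrite wl'T subr_gt0.
clearbody lam1 lam2.
have l1 W : spin_prob lam1 W = L W / p.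
  by rewrite /spin_prob l1A//; exact: ones_config.
have l2 W : spin_prob lam2 W = (g W - L W) / (1 - p).
  by rewrite /spin_prob l2A//; exact: ones_config.
have mixE (x y : R) : x = p * (y / p) + (1 - p) * ((x - y) / (1 - p)).
  by rewrite !mulrA ![_ * _ / _]mulrAC !mulfV ?gt_eqF ?subr_gt0// !mul1r; ring.
have ratio_eq (x y : R) : y / p = (x - y) / (1 - p) -> y = p * x.
  have pn0 : p != 0 by rewrite gt_eqF.
  have qn0 : 1 - p != 0 by rewrite gt_eqF ?subr_gt0.
  by move=> /eqP; rewrite eqr_div// => /eqP ?; lra.
have Lc W : far_spin Q g (- n%:Z) u W @[n --> \oo] --> L W.
  have e n : (0 <= n)%N -> far_spin Q g (- n%:Z) u W = weighted lam M n (ones W).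
    by move=> _; rewrite wE.
  exact: (cvg_near_eq e (cM _ (ones_config W))).
have L01 W : 0 <= L W <= 1.
  apply/andP; split; first exact: (wlim_ge0 M01 cM (ones_config W)).
  apply: le_trans (wlim_le bM M01 cM (ones_config W)) _.
  by have /andP[] := sf_unit sg W.
(* Pass to the limit in the harmonicity of far_spin, valid once -n <= x. *)
have hL : coalescing_harmonic Q L.
  move=> x W.
  have [||_ c] := @Ex_cvg _ _ _ Q
    (fun n f => far_spin Q g (- n%:Z) u (map (hit f x) W))
    (fun f => L (map (hit f x) W)) 1 _ _ (fun f => @Lc (map (hit f x) W)).
  - move=> n; have [] // := bmf_hits x W (phi := far_spin Q g (- n%:Z) u) _.
    by move=> V'; exact: far_spin_unit.
  - move=> n f; have /andP[h0 h1] := far_spin_unit Q sg (- n%:Z) u (map (hit f x) W).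
    by rewrite ger0_norm.
  have e n : (`|x| <= n)%N -> far_spin Q g (- n%:Z) u W =
      \int[Q]_f far_spin Q g (- n%:Z) u (map (hit f x) W).
    by move=> xn; apply: far_spin_harmonic_tail => //; lia.
  have c' := cvg_near_eq e c.
  exact: (etrans (esym (cvg_lim (@Rhausdorff R) (@Lc W))) (cvg_lim (@Rhausdorff R) c')).
have bL x W := bmf_hits x W L01.
have bg x W := bmf_hits x W (sf_unit sg).
have G1 : gibbs k lam1.
  apply/(gibbsP mu_pos hk) => x W; rewrite l1 (hL x) mulrC -ExZ//.
  by apply: eq_Ex => f; rewrite l1 mulrC.
have G2 : gibbs k lam2.
  apply/(gibbsP mu_pos hk) => x W.
  rewrite l2 (hL x) {1}(hg x) mulrC -ExB// -ExZ; last exact: bmfB.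
  by apply: eq_Ex => f; rewrite l2 mulrC.
have p01 : 0 < p < 1 by rewrite p0 p1.
suff LV : L V = p * g V by rewrite -LV; exact: Lc.
have mix : same_law lam (fun A => p%:E * lam1 A + (1 - p)%:E * lam2 A)%E.
  move=> A mA; rewrite (l1A A mA) (l2A A mA) -!EFinM -EFinD -mixE.
  exact: esym (fineK_prob lam mA).
have := congr1 fine (ext _ _ p G1 G2 p01 mix (ones V) (ones_config V)).
by rewrite -/(spin_prob lam1 V) -/(spin_prob lam2 V) l1 l2; exact: ratio_eq.
Qed.

Section coins.
Variables (p : R) (c : int -> {RV P >-> bool}).
Hypotheses (p01 : 0 <= p <= 1) (hc : component_coins k p c).
Local Notation lamp := (coin_colored_law k c).

(** Two sites have equal coins if they are connected and independent ones otherwise. *)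
Lemma coin_far_variance y u :
  far_variance Q (spin_prob lamp) p y u = (p - p ^+ 2) * indep_meet Q y u u.
Proof.
rewrite /far_variance (_ : far_spin _ _ _ _ [::] = p); last first.
  by rewrite -[RHS](Ex_cst Q); apply: eq_Ex => f; exact: (spin_prob_coin1 mu_pos hk p01 hc).
have bq b : bounded_mfun (fun f => (p - p ^+ 2) * pair_meet Q b (hit f y u)).
  apply: bmfM; first exact: bmf_cst.
  by apply: (bmf_hit (phi := pair_meet Q b)) => a; exact: pair_meet_unit.
have far b : far_spin Q (spin_prob lamp) y u [:: b] =
    p ^+ 2 + (p - p ^+ 2) * \int[Q]_f pair_meet Q b (hit f y u).
  rewrite -ExZ; last first.
    by apply: (bmf_hit (phi := pair_meet Q b)) => a; exact: pair_meet_unit.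
  rewrite -[X in X + _](Ex_cst Q) -ExD; [|exact: bmf_cst|].
    by apply: eq_Ex => f; rewrite (spin_prob_coin2 mu_pos hk p01 hc) pair_meetC.
  exact: bq.
have bt : bounded_mfun (fun f => \int[Q]_f0 pair_meet Q (hit f y u) (hit f0 y u)).
  apply: (bmf_hit (phi := fun b => \int[Q]_f0 pair_meet Q b (hit f0 y u))) => b.
  exact: indep_meet_tail_unit.
have -> : \int[Q]_f far_spin Q (spin_prob lamp) y u [:: hit f y u] =
    p ^+ 2 + (p - p ^+ 2) * indep_meet Q y u u.
  rewrite /indep_meet -ExZ// -[X in X + _](Ex_cst Q) -ExD; [|exact: bmf_cst|].
    by apply: eq_Ex => f; exact: far.
  by apply: bmfM => //; exact: bmf_cst.
by ring.
Qed.

Hypothesis no_merge : exists a b, pair_meet Q a b < 1.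

Lemma coin_variance_cvg u :
  far_variance Q (spin_prob lamp) p (- n%:Z) u @[n --> \oo] --> (0 : R).
Proof.
have e n : (0 <= n)%N -> far_variance Q (spin_prob lamp) p (- n%:Z) u =
    (p - p ^+ 2) * indep_meet Q (- n%:Z) u u by move=> _; exact: coin_far_variance.
apply: (cvg_near_eq e); rewrite -(mulr0 (p - p ^+ 2)); apply: cvgM; first exact: cvg_cst.
exact: (tail_meet0 (step_law_indep hk) (step_law_marginal mu_pos hk) mu_gcd no_merge).
Qed.

Lemma far_variance_convex (g g1 g2 : seq int -> R) (t : R) y u :
  spin_function g1 -> spin_function g2 ->
  (forall V, g V = t * g1 V + (1 - t) * g2 V) ->
  far_variance Q g p y u =
  t * far_variance Q g1 p y u + (1 - t) * far_variance Q g2 p y u.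
Proof.
move=> s1 s2 gE.
have b g' V : spin_function g' -> bounded_mfun (fun f => g' (hit f y u :: V)).
  by move=> s; apply: (bmf_hit (phi := fun a => g' (a :: V))) => a; exact: sf_unit s _.
have farE V : far_spin Q g y u V =
    t * far_spin Q g1 y u V + (1 - t) * far_spin Q g2 y u V.
  rewrite /far_spin -!ExZ; [|exact: b|exact: b].
  rewrite -ExD; first by apply: eq_Ex => f; exact: gE.
  - by apply: bmfM; [exact: bmf_cst|exact: b].
  - by apply: bmfM; [exact: bmf_cst|exact: b].
have b2 g' : spin_function g' -> bounded_mfun (fun f => far_spin Q g' y u [:: hit f y u]).
  move=> s; apply: (bmf_hit (phi := fun a => far_spin Q g' y u [:: a])) => a.
  exact: far_spin_unit.
rewrite /far_variance farE.
have -> : \int[Q]_f far_spin Q g y u [:: hit f y u] =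
    t * \int[Q]_f far_spin Q g1 y u [:: hit f y u] +
    (1 - t) * \int[Q]_f far_spin Q g2 y u [:: hit f y u].
  rewrite -!ExZ; [|exact: b2|exact: b2].
  rewrite -ExD; first by apply: eq_Ex => f; exact: farE.
  - by apply: bmfM; [exact: bmf_cst|exact: b2].
  - by apply: bmfM; [exact: bmf_cst|exact: b2].
by ring.
Qed.

(** The variance is affine in the measure and nonnegative, so it tends to zero under
lam1 because it does under the mixture. *)
Lemma coin_component_eq (lam1 lam2 : probability config R) (t : R) :
  gibbs k lam1 -> 0 < t < 1 ->
  (forall V, spin_prob lamp V = t * spin_prob lam1 V + (1 - t) * spin_prob lam2 V) ->
  spin_prob lam1 = spin_prob lamp.
Proof.
move=> G1 /andP[t0 t1] gE.
have v1 u : far_variance Q (spin_prob lam1) p (- n%:Z) u @[n --> \oo] --> (0 : R).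
  apply: (@squeeze_cvgr _ _ _ _ (fun=> 0)
    (fun n => t^-1 * far_variance Q (spin_prob lamp) p (- n%:Z) u)).
  - apply: nearW => n; rewrite far_variance_ge0 /=.
    rewrite (far_variance_convex _ _ (spin_prob_function lam1) (spin_prob_function lam2) gE).
    rewrite mulrDr mulrA mulVf ?gt_eqF// mul1r lerDl mulr_ge0//.
      by rewrite invr_ge0 ltW.
    by rewrite mulr_ge0 ?far_variance_ge0// subr_ge0 ltW.
  - exact: cvg_cst.
  - by rewrite -(mulr0 t^-1); apply: cvgM; [exact: cvg_cst|exact: coin_variance_cvg].
apply: (spin_function_unique (step_law_indep hk) (p := p)).
- exact: spin_prob_function.
- exact: (gibbsP mu_pos hk lam1).1 G1.
- exact: variance_density v1.
- exact: spin_prob_function.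
- exact: (coin_colored_harmonic mu_pos hk p01 hc).
- exact: variance_density coin_variance_cvg.
Qed.

Lemma coin_extremal (lam : probability config R) :
  same_law lam (lambda_law k c) -> extremal_gibbs k lam.
Proof.
move=> lamE.
have gE : spin_prob lam = spin_prob lamp.
  by apply/funext => V; rewrite /spin_prob lamE//; exact: ones_config.
split.
  apply/(gibbsP mu_pos hk); rewrite gE.
  exact: (coin_colored_harmonic mu_pos hk p01 hc).
move=> lam1 lam2 t G1 G2 t01 lam12; apply: same_law_spin_prob.
have mix V : spin_prob lamp V = t * spin_prob lam1 V + (1 - t) * spin_prob lam2 V.
  apply: EFin_inj; rewrite -gE EFinD !EFinM !spin_probE.
  by rewrite lam12//; exact: ones_config.
rewrite (coin_component_eq G1 t01 mix).
apply/esym; apply: (coin_component_eq (lam2 := lam1) (t := 1 - t) G2).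
  by move: t01 => /andP[? ?]; apply/andP; split; lra.
by move=> V; rewrite mix; ring.
Qed.

Lemma extremal_coin lam : extremal_gibbs k lam -> p = spin_prob lam [:: 0] ->
  same_law lam (lambda_law k c).
Proof.
move=> ext pE A mA; rewrite -coin_colored_lawE.
apply: same_law_spin_prob mA.
apply: (spin_function_unique (step_law_indep hk) (p := p)).
- exact: spin_prob_function.
- by apply/(gibbsP mu_pos hk); case: ext.
- by rewrite pE; exact: extremal_density.
- exact: spin_prob_function.
- exact: (coin_colored_harmonic mu_pos hk p01 hc).
- exact: variance_density coin_variance_cvg.
Qed.

End coins.
End extremal_measures.

(** * One component or infinitely many *)

Section almost_sure_components.
Variables (R : realType) (mu : probability nat R) (d : measure_display)
  (Omega : measurableType d) (P : probability Omega R).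
Hypothesis mu_pos : mu [set 0%N] = 0%E.
Variable k : int -> {RV P >-> nat}.
Hypothesis hk : samples_graph mu k.
Local Notation Q := (step_law k).

Lemma measurable_steps_component a b :
  measurable [set w | component (steps k w) a b].
Proof.
have := measurable_steps k measurableT (Y := [set kk | component kk a b]).
by rewrite setTI; apply; exact: measurable_component.
Qed.

Lemma pair_meet_steps a b :
  (pair_meet Q a b)%:E = P [set w | component (steps k w) a b].
Proof.
rewrite pair_meetE fineK_prob; last exact: measurable_linked.
have := step_lawE mu_pos hk (A := [set kk | component kk a b]).
by move=> /(_ (measurable_component a b)) ->.
Qed.

Lemma pair_meet_ae a b : pair_meet Q a b = 1 <->
  {ae P, forall w, component (steps k w) a b}.
Proof.
have mA := measurable_steps_component a b; set A := mkset _ in mA.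
have mC := measurableC mA.
have CE : (pair_meet Q a b)%:E = (1 - P (~` A))%E.
  by rewrite pair_meet_steps -(probability_setC P mC) setCK.
split=> [e|ae].
  apply/(negligibleP _ mC); apply: etrans (probability_setC P mA) _.
  by rewrite -[P A]pair_meet_steps e subee.
have C0 : P (~` A) = 0%E by apply: (measure_negligible mC ae).
by apply: EFin_inj; rewrite CE C0 sube0.
Qed.

Lemma ae_linked : (forall a b, pair_meet Q a b = 1) ->
  {ae P, forall w, forall a b, component (steps k w) a b}.
Proof.
move=> q1.
have : {ae P, forall w, forall n : nat,
    if choice.unpickle n is Some a then component (steps k w) 0 a else True}.
  apply: ae_foralln => n; case: (choice.unpickle n) => [a|]; last exact: aeW.
  exact/pair_meet_ae.
apply: filterS => w H a b.
have H0 u : component (steps k w) 0 u by have := H (choice.pickle u); rewrite choice.pickleK.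
exact: component_trans (component_sym (H0 a)) (H0 b).
Qed.

Lemma pair_meet_one_component :
  {ae P, forall w, exists C, components (steps k w) = [set C]} ->
  forall a b, pair_meet Q a b = 1.
Proof.
move=> H a b; apply/pair_meet_ae; apply: filterS H => w [C CE].
have in_C z : component (steps k w) z = C.
  have : components (steps k w) (component (steps k w) z) by exists z.
  by rewrite CE.
by rewrite in_C -(in_C b); exact: component_refl.
Qed.

(** If all pairs met almost surely, almost every graph would have a single component. *)
Lemma pair_meet_many_components :
  {ae P, forall w, infinite_set (components (steps k w))} ->
  exists a b, pair_meet Q a b < 1.
Proof.
move=> H; apply: contrapT => nq.
have q1 a b : pair_meet Q a b = 1.
  apply/eqP; rewrite eq_le; have /andP[_ ->] /= := pair_meet_unit Q a b.
  by rewrite leNgt; apply/negP => ab; apply: nq; exists a, b.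
have P0 : (P setT > 0)%E by rewrite (probability_setT P) lte01.
have PF := ae_properfilter_algebraOfSetsType P0.
have [w [Hw Lw]] := filter_ex (filterI H (ae_linked q1)).
apply: Hw; rewrite (_ : components _ = [set component (steps k w) 0]).
  exact: finite_set1.
apply/seteqP; split=> [_ [z _ <-]|_ ->]; last by exists 0.
exact/component_eq/Lw.
Qed.

End almost_sure_components.

Section one_component.
Variables (R : realType) (Q : probability steps_space R).
Hypothesis q1 : forall a b, pair_meet Q a b = 1.
Variable g : seq int -> R.
Hypotheses (sg : spin_function g) (hg : coalescing_harmonic Q g).

(** The line of u merges with the line of v, and then u adds nothing to the list. *)
Lemma one_component_cons u v V : g (u :: v :: V) = g (v :: V).
Proof.
set W := v :: V.
have mW : meet_prob Q u W = 1.
  apply/eqP; rewrite eq_le; have /andP[_ ->] /= := meet_prob_unit Q u W.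
  rewrite -(q1 u v); apply: Ex_le; [exact: bmf_meeting|exact: bmf_meeting|move=> f].
  rewrite !indicE ler_nat; case: (boolP (f \in meeting u [:: v])) => // uv.
  rewrite mem_set//; move: uv; rewrite inE => -[w]; rewrite inE => /eqP -> uv.
  by exists v => //; rewrite inE eqxx.
suff H : `|g (u :: W) - g W| <= 0.
  by apply/eqP; rewrite -subr_eq0 -normr_le0.
have Hx x : `|g (u :: W) - g W| <= 1 - merged_by Q x u W.
  have bm := bmf_merged R x u W.
  have b1 := bmf_hits x (u :: W) (sf_unit sg).
  have b2 := bmf_hits x W (sf_unit sg).
  rewrite (hg x (u :: W)) (hg x W) -ExB// -[X in X - _](Ex_cst Q) -ExB//; last exact: bmf_cst.
  apply: Ex_norm_le; [exact: bmfB|by apply: bmfB => //; exact: bmf_cst|move=> f].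
  rewrite map_cons; set a := hit f x u; set W' := map _ _.
  have [aW|aW] := boolP (a \in W'); last first.
    have := sf_unit sg (a :: W'); have := sf_unit sg W' => /andP[? ?] /andP[? ?].
    by rewrite subr0 ler_norml; apply/andP; split; lra.
  rewrite (sf_mem sg (V := a :: W') (W := W')) ?subrr ?normr0// => z.
  by rewrite inE; case: eqP => // ->; rewrite aW.
have c : 1 - merged_by Q (- n%:Z) u W @[n --> \oo] --> 1 - meet_prob Q u W.
  by apply: cvgB; [exact: cvg_cst|exact: merged_by_cvg].
rewrite mW subrr in c.
rewrite -(cvg_lim (@Rhausdorff R) c); apply: limr_ge.
  by apply/cvg_ex; eexists; exact: c.
by apply: nearW => n; exact: Hx.
Qed.

Lemma one_component_cst u V : g (u :: V) = g [:: 0].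
Proof.
have g1 v : g [:: v] = g [:: 0].
  rewrite -(one_component_cons 0 v [::]) -(one_component_cons v 0 [::]).
  by apply: (sf_mem sg) => z; rewrite !inE orbC.
elim: V u => [|v V IH] u; first exact: g1.
by rewrite one_component_cons IH.
Qed.

End one_component.

Lemma spin_prob_dirac (R : realType) b V :
  spin_prob (dirac ((fun=> b) : config) : probability config R) V =
  (b || (V == [::]))%:R.
Proof.
transitivity ((((fun=> b) : config) \in ones V)%:R : R); first by [].
congr (nat_of_bool _)%:R.
apply/idP/idP; rewrite inE /ones/=.
  by case: V => [|v V] /=; rewrite ?orbT// => /andP[->].
by case: b => /= [_|/eqP -> //]; exact/allP.
Qed.

Lemma gibbs_dirac (R : realType) (mu : probability nat R) (d : measure_display)
    (Omega : measurableType d) (P : probability Omega R)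
    (k : int -> {RV P >-> nat}) b :
  mu [set 0%N] = 0%E -> samples_graph mu k ->
  gibbs k (dirac ((fun=> b) : config)).
Proof.
move=> mu_pos hk; apply/(gibbsP mu_pos hk) => x V.
rewrite -[LHS](Ex_cst (step_law k)); apply: eq_Ex => f.
by rewrite !spin_prob_dirac; case: V.
Qed.

Section constant_configurations.
Variables (R : realType) (mu : probability nat R) (d : measure_display)
  (Omega : measurableType d) (P : probability Omega R).
Hypothesis mu_pos : mu [set 0%N] = 0%E.
Variable k : int -> {RV P >-> nat}.
Hypothesis hk : samples_graph mu k.

Lemma constant_config_measurable (X : {RV P >-> bool}) :
  measurable_fun setT (fun w => (fun=> X w) : config).
Proof.
apply: measurable_to_spins => z _ A.
by have := measurable_funPTI X (Y := A); apply.
Qed.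

(** Realizes the mixture of the two Dirac masses as an image measure, so that it can
be compared with lam on the events ones V only. *)
Lemma constant_config_law (X : {RV P >-> bool}) (p : R) (A : set config) :
  P (X @^-1` [set true]) = p%:E ->
  P [set w | A (fun=> X w)] = (p%:E * dirac ((fun=> true) : config) A +
    (1 - p)%:E * dirac ((fun=> false) : config) A)%E.
Proof.
move=> XT.
have mT : measurable (X @^-1` [set true]) by exact: measurable_funPTI.
have XF : P (X @^-1` [set false]) = (1 - p)%:E.
  rewrite (_ : _ @^-1` _ = ~` (X @^-1` [set true])).
    by rewrite probability_setC// XT EFinB.
  by apply/seteqP; split=> w /=; case: (X w).
have memA b : ((fun=> b) : config) \in A = `[< A (fun=> b) >].
  by apply/idP/asboolP; rewrite inE.
rewrite !diracE !memA; case: asboolP => At; case: asboolP => Af.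
- rewrite (_ : mkset _ = setT) ?probability_setT ?mule1 -?EFinD.
    by congr (_%:E); ring.
  by apply/seteqP; split=> w //= _; case: (X w).
- rewrite (_ : mkset _ = X @^-1` [set true]) ?XT ?mule1 ?mule0 ?adde0//.
  by apply/seteqP; split=> w /=; case: (X w).
- rewrite (_ : mkset _ = X @^-1` [set false]) ?XF ?mule1 ?mule0 ?add0e//.
  by apply/seteqP; split=> w /=; case: (X w).
- rewrite (_ : mkset _ = set0) ?measure0 ?mule0 ?adde0//.
  by apply/seteqP; split=> w //=; case: (X w).
Qed.

(** On the events ones V a Dirac mass takes the values 0 and 1 only, which are
extreme points of the unit interval. *)
Lemma dirac_extremal b (lam : probability config R) :
  same_law lam (dirac ((fun=> b) : config)) -> extremal_gibbs k lam.
Proof.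
move=> lamb.
have gE : spin_prob lam =
    spin_prob (dirac ((fun=> b) : config) : probability config R).
  by apply/funext => V; rewrite /spin_prob lamb//; exact: ones_config.
split.
  apply/(gibbsP mu_pos hk); rewrite gE.
  exact: (gibbsP mu_pos hk _).1 (gibbs_dirac b mu_pos hk).
move=> lam1 lam2 t _ _ /andP[t0 t1] lam12; apply: same_law_spin_prob.
apply/funext => V.
have /andP[h1 h2] := sf_unit (spin_prob_function lam1) V.
have /andP[h3 h4] := sf_unit (spin_prob_function lam2) V.
have mix : spin_prob lam V = t * spin_prob lam1 V + (1 - t) * spin_prob lam2 V.
  apply: EFin_inj; rewrite EFinD !EFinM !spin_probE lam12//.
  exact: ones_config.
move: mix; rewrite gE spin_prob_dirac; case: (_ || _) => /= mix; nra.
Qed.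

Hypothesis q1 : forall a b, pair_meet (step_law k) a b = 1.
Variable lam : probability config R.
Local Notation p := (spin_prob lam [:: 0]).

Lemma one_component_extremal (X : {RV P >-> bool}) :
  P (X @^-1` [set true]) = p%:E -> extremal_gibbs k lam ->
  exists b, same_law lam (dirac ((fun=> b) : config)).
Proof.
move=> XT [G ext]; have sg : spin_function (spin_prob lam) := spin_prob_function lam.
have gE u V : spin_prob lam (u :: V) = p.
  exact: (one_component_cst q1 sg ((gibbsP mu_pos hk lam).1 G)).
have p01 : 0 <= p <= 1 := sf_unit sg _.
have diracP (b : bool) : p = b%:R -> same_law lam (dirac ((fun=> b) : config)).
  move=> pb; apply: same_law_spin_prob; apply/funext => V.
  rewrite spin_prob_dirac; case: V => [|u V].
    by rewrite orbT; exact: sf_nil sg.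
  by rewrite gE pb orbF.
have [p0|pn0] := eqVneq p 0; first by exists false; exact: diracP.
have [p1|pn1] := eqVneq p 1; first by exists true; exact: diracP.
have p01' : 0 < p < 1.
  by move: p01 => /andP[? ?]; rewrite !lt_neqAle eq_sym pn0 pn1; apply/andP.
have mixture : same_law lam (fun A => p%:E * dirac ((fun=> true) : config) A +
    (1 - p)%:E * dirac ((fun=> false) : config) A)%E.
  move=> A mA; rewrite -(constant_config_law A XT).
  pose mX := constant_config_measurable X.
  apply: (same_law_spin_prob (lam' := law P mX)) mA; apply/funext => -[|u V].
    by rewrite !(sf_nil (spin_prob_function _)).
  rewrite gE; have EX : law P mX (ones (u :: V)) = p%:E.
    rewrite (lawE P mX) -XT; congr (P _).
    apply/seteqP; split=> w; first by rewrite /ones/= => /andP[].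
    by move=> cw; rewrite /ones/= cw; exact/allP.
  by rewrite [RHS]/spin_prob EX.
have E := ext _ _ p (gibbs_dirac true mu_pos hk) (gibbs_dirac false mu_pos hk)
  p01' mixture (ones [:: 0]) (ones_config _).
have /eqP : spin_prob (dirac ((fun=> true) : config) : probability config R) [:: 0]
    = spin_prob (dirac ((fun=> false) : config) : probability config R) [:: 0].
  by rewrite /spin_prob E.
by rewrite !spin_prob_dirac oner_eq0.
Qed.

End constant_configurations.

Theorem proposition1 (R : realType) (mu : probability nat R)
    (mu_pos : mu [set 0%N] = 0%E)
    (mu_gcd : is_gcd (law_support mu) 1)
    (d : measure_display) (Omega : measurableType d) (P : probability Omega R)
    (k : int -> {RV P >-> nat}) (hk : samples_graph mu k)
    (c : R -> int -> {RV P >-> bool})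
    (hc : forall p : R, 0 <= p <= 1 -> component_coins k p (c p)) :
  ({ae P, forall w, exists C, components (steps k w) = [set C]} ->
     forall lam : probability config R,
       extremal_gibbs k lam <->
       same_law lam (dirac ((fun _ => false) : config)) \/
       same_law lam (dirac ((fun _ => true) : config)))
  /\
  ({ae P, forall w, infinite_set (components (steps k w))} ->
     (forall p : R, 0 <= p <= 1 ->
        exists lam : probability config R, same_law lam (lambda_law k (c p))) /\
     (forall lam : probability config R,
        extremal_gibbs k lam <->
        exists2 p : R, 0 <= p <= 1 & same_law lam (lambda_law k (c p)))).
Proof.
split=> [one lam|many].
  have q1 := pair_meet_one_component mu_pos hk one.
  split=> [ext|].
    have p01 : 0 <= spin_prob lam [:: 0] <= 1 := sf_unit (spin_prob_function lam) _.
    have [[] lamb] := one_component_extremal mu_pos hk q1 ((hc _ p01).1 0) ext.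
      by right.
    by left.
  by case=> lamb; exact: (dirac_extremal mu_pos hk lamb).
have nm := pair_meet_many_components mu_pos hk many.
split=> [p p01|lam]; first by exists (coin_colored_law k (c p)).
split=> [ext|[p p01 lamp]].
  have p01 : 0 <= spin_prob lam [:: 0] <= 1 := sf_unit (spin_prob_function lam) _.
  exists (spin_prob lam [:: 0]) => //.
  exact: (extremal_coin mu_pos mu_gcd hk p01 (hc _ p01) nm ext erefl).
exact: (coin_extremal mu_pos mu_gcd hk p01 (hc p p01) nm lamp).
Qed.
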